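(* Let $d\ge1$, $\tau>0$, and let $E=C([-\tau,0],\mathbb{R}^d)$ be endowed with the sup-norm. Suppose that $K:\mathbb{R}^d\times E\to\mathbb{R}^d$ is globally Lipschitz, i.e. there exists $L>0$ such that $|K(x,\sigma)-K(\tilde x,\tilde\sigma)|\le L(|x-\tilde x|+\|\sigma-\tilde\sigma\|_\infty)$ for all $x,\tilde x\in\mathbb{R}^d$ and all $\sigma,\tilde\sigma\in E$. (i) For any $R_0>0$ and any initial distribution $\mu(0)\in\mathbb{P}(E)$ supported in the ball $B_0(R_0)\subset E$, there exists a unique path-wise solution of the random delay differential equation $$X'(t)=\mathcal{F}[\mu](t,X(t))=\int_E K(X(t),\sigma)\,\mu(t)(d\sigma),\qquad \mu(t)=\mathcal{L}(X_t),\quad t\ge 0,$$ with initial condition a given $E$-valued random variable $X_0$ with $\mathcal{L}(X_0)=\mu(0)$. (ii) Moreover, there exists a continuous function $r:[0,+\infty)\to[0,+\infty)$ with $r(0)=1$ such that, given two initial conditions $\mu_{in},\nu_{in}\in\mathbb{P}(E)$ supported in some ball $B_0(R_0)$, the laws $\mu(t)=\mathcal{L}(X_t)$ and $\nu(t)=\mathcal{L}(Y_t)$ of the corresponding solutions $X$, $Y$ satisfy $$W_1(\mu(t),\nu(t))\le r(t)\,W_1(\mu_{in},\nu_{in})\qquad\text{for all } t\ge 0.$$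
   Context: $\mathbb{P}(E)$ is the set of Borel probability measures on $E=C([-\tau,0],\mathbb{R}^d)$, where $\|\sigma\|_\infty=\max_{s\in[-\tau,0]}|\sigma(s)|$, and $B_0(R)=\{\sigma\in E:\|\sigma\|_\infty\le R\}$. $\mathbb{P}_1(E)\subset\mathbb{P}(E)$ is the set of measures with finite first moment, with the Monge-Kantorovich distance $W_1(\mu,\nu)=\sup\{\int_E\varphi\,d(\mu-\nu):\varphi:E\to\mathbb{R},\ Lip(\varphi)\le1\}$. For a continuous path $x:[-\tau,\infty)\to\mathbb{R}^d$ and $t\ge0$, $x_t\in E$ is $x_t(s)=x(t+s)$, $s\in[-\tau,0]$. $\mathcal{L}(Z)$ denotes the law of a random variable $Z$. For a continuous curve $\mu:[0,\infty)\to\mathbb{P}_1(E)$, $\mathcal{F}[\mu](t,x)=\int_E K(x,\sigma)\,\mu(t)(d\sigma)$. Path-wise solution: given a probability space $\Omega$ and a random variable $X_0:\Omega\to E$ with law $\mu(0)$, a path-wise solution is a process $X$ on $\Omega$ with continuous paths $[-\tau,\infty)\to\mathbb{R}^d$ such that, with $\mu(t)=\mathcal{L}(X_t)$ and $\mu\in C([0,\infty),\mathbb{P}_1(E))$, for almost every $\omega\in\Omega$, $$X(t)(\omega)=X_0(0)(\omega)+\int_0^t\mathcal{F}[\mu](s,X(s)(\omega))\,ds\quad (t\ge0),\qquad X(t)(\omega)=X_0(t)(\omega)\quad(t\in[-\tau,0]).$$ Uniqueness means uniqueness of $X$ up to almost sure equality, for the given $X_0$. *)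

(* Defs.v *)
From HB Require Import structures.
From mathcomp Require Import all_boot all_order all_algebra.
From mathcomp Require Import all_classical all_reals all_analysis.
From mathcomp Require Import ring.

Set Implicit Arguments.
Unset Strict Implicit.
Unset Printing Implicit Defensive.
Import Order.TTheory GRing.Theory Num.Theory.
Import numFieldNormedType.Exports.
Local Open Scope classical_set_scope.
Local Open Scope ring_scope.

(* The library norm of 'rV[R]_d is the max norm; it induces the topology used
   below, but all distances are measured with the Euclidean norm. *)
Definition enorm (R : realType) (d : nat) (x : 'rV[R]_d) : R :=
  Num.sqrt (\sum_(i < d) x 0 i ^+ 2).

Section enorm_theory.
Context {R : realType} {d : nat}.
Implicit Types x y : 'rV[R]_d.

Lemma enorm_ge0 x : 0 <= enorm x.
Proof. exact: sqrtr_ge0. Qed.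

Lemma enorm_sqr x : enorm x ^+ 2 = \sum_(i < d) x 0 i ^+ 2.
Proof. by rewrite sqr_sqrtr// sumr_ge0// => i _; exact: sqr_ge0. Qed.

Lemma enormZ (a : R) x : enorm (a *: x) = `|a| * enorm x.
Proof.
rewrite /enorm -sqrtr_sqr -sqrtrM ?sqr_ge0// mulr_sumr; congr Num.sqrt.
by apply: eq_bigr => i _; rewrite mxE exprMn.
Qed.

Lemma enorm0_eq0 x : enorm x = 0 -> x = 0.
Proof.
move=> x0; have /eqP := enorm_sqr x.
rewrite x0 expr0n/= eq_sym psumr_eq0 => [/allP x0'|i _]; last exact: sqr_ge0.
apply/rowP => i; rewrite mxE; have := x0' i (mem_index_enum i).
by rewrite sqrf_eq0 => /eqP.
Qed.

Lemma enorm_cauchy_schwarz x y :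
  \sum_(i < d) x 0 i * y 0 i <= enorm x * enorm y.
Proof.
have [x0|x0] := eqVneq (enorm x) 0.
  rewrite x0 mul0r (enorm0_eq0 x0) big1// => i _.
  by rewrite mxE mul0r.
have [y0|y0] := eqVneq (enorm y) 0.
  rewrite y0 mulr0 (enorm0_eq0 y0) big1// => i _.
  by rewrite mxE mulr0.
have xp : 0 < enorm x by rewrite lt_neqAle eq_sym x0 enorm_ge0.
have yp : 0 < enorm y by rewrite lt_neqAle eq_sym y0 enorm_ge0.
have : 0 <= \sum_(i < d) (enorm y * x 0 i - enorm x * y 0 i) ^+ 2.
  by apply: sumr_ge0 => i _; exact: sqr_ge0.
rewrite (eq_bigr (fun i => enorm y ^+ 2 * x 0 i ^+ 2
    + enorm x ^+ 2 * y 0 i ^+ 2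
    - 2 * (enorm x * enorm y) * (x 0 i * y 0 i))); last by move=> i _; ring.
rewrite sumrB big_split/= -!mulr_sumr -!enorm_sqr.
set s := \sum_(i < d) _.
rewrite (_ : _ - _ = 2 * (enorm x * enorm y) * (enorm x * enorm y - s));
  last by ring.
by rewrite pmulr_rge0 ?subr_ge0// mulr_gt0// mulr_gt0.
Qed.

Lemma ler_enormD x y : enorm (x + y) <= enorm x + enorm y.
Proof.
rewrite -(@ler_pXn2r _ 2)// ?nnegrE ?addr_ge0 ?enorm_ge0//.
rewrite enorm_sqr (eq_bigr (fun i => x 0 i ^+ 2 + y 0 i ^+ 2
  + 2 * (x 0 i * y 0 i))); last by move=> i _; rewrite mxE; ring.
rewrite big_split/= big_split/= -mulr_sumr -!enorm_sqr.
have := enorm_cauchy_schwarz x y; set s := \sum_(i < d) _ => h.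
rewrite (_ : (_ + _) ^+ 2 =
  enorm x ^+ 2 + enorm y ^+ 2 + 2 * (enorm x * enorm y)); last by ring.
by rewrite lerD2l ler_pM2l.
Qed.

Lemma enorm_continuous : continuous (@enorm R d).
Proof.
move=> x; apply: (@continuous_comp _ _ _
  (fun x : 'rV[R]_d => \sum_(i < d) x 0 i ^+ 2) Num.sqrt); last first.
  exact: sqrt_continuous.
apply: (@cvg_big _ _ _ _ _ add_continuous _ (nbhs x)) => i _.
apply: (@continuous_comp _ _ _ (fun x : 'rV[R]_d => x 0 i) (fun r => r ^+ 2)).
  exact: coord_continuous.
exact: exprn_continuous.
Qed.
End enorm_theory.

Section history.
Variables (R : realType) (d : nat) (tau : R).

Definition delay : Type := set_type (`[- tau, 0]%classic : set R).
HB.instance Definition _ := Topological.on delay.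

Definition history : Type := continuousType delay 'rV[R]_d.

Definition is_history : {pred delay -> 'rV[R]_d} :=
  fun f => `[< continuous f >].

Definition history_fun (f : history) : delay -> 'rV[R]_d := f.

Definition history_Sub (f : delay -> 'rV[R]_d) (fP : f \in is_history) :
  history := mkcts (asboolW fP).

Lemma history_rect (P : history -> Type) :
  (forall f (fP : f \in is_history), P (history_Sub fP)) -> forall u, P u.
Proof.
move=> h f; have fP : (f : delay -> _) \in is_history.
  by apply/asboolP; exact: cts_fun.
suff -> : f = history_Sub fP by exact: h.
exact/continuousEP.
Qed.

HB.instance Definition _ :=
  @isSub.Build _ _ history history_fun history_Sub history_rect
    (fun _ _ => erefl).
HB.instance Definition _ := [Choice of history by <:].

Lemma is_history_submod : submod_closed is_history.
Proof.
split=> [|a f g /asboolP cf /asboolP cg]; apply/asboolP => x.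
  exact: (@cst_continuous _ _ (0 : 'rV[R]_d)).
have ca : continuous_at x (a \*: f).
  exact: (continuous_comp (cf x) (@scaler_continuous _ _ a (f x))).
exact: (@continuousD _ _ _ (a \*: f) g x ca (cg x)).
Qed.
HB.instance Definition _ :=
  GRing.isSubmodClosed.Build R _ is_history is_history_submod.
HB.instance Definition _ := [SubChoice_isSubLmodule of history by <:].


Definition history_norm (f : history) : R :=
  sup (range (fun s : delay => enorm (f s))).

Lemma history_norm_has_ubound (f : history) :
  has_ubound (range (fun s : delay => enorm (f s))).
Proof.
have [tau0|tau0] := leP (- tau) 0; last first.
  exists 0 => _ [s _ <-]; exfalso.
  have := set_valP s; rewrite /= in_itv/= => /andP[h1 h2].
  by have := lt_le_trans tau0 (le_trans h1 h2); rewrite ltxx.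
pose g (s : delay) := enorm (f s).
have cg : continuous g.
  move=> s; apply: continuous_comp; first exact: cts_fun.
  exact: enorm_continuous.
have /(EVT_max tau0)[c _ cmax] : {within `[- tau, 0], continuous (valL_ 0 g)}.
  exact/subspace_valL_continuousP'.
exists (valL_ 0 g c) => _ [s _ <-].
have := cmax (set_val s) (set_valP s).
by rewrite [leLHS](_ : _ = g s)//; exact: (congr1 (@^~ s) (valLK 0 g)).
Qed.

Lemma le_history_norm (f : history) s : enorm (f s) <= history_norm f.
Proof. by apply: sup_ubound; [exact: history_norm_has_ubound|exists s]. Qed.

Lemma history_norm_le (f : history) r : 0 <= r ->
  (forall s, enorm (f s) <= r) -> history_norm f <= r.
Proof.
move=> r0 fr; have [[x ex]|/nonemptyPn e0] :=
  pselect (range (fun s : delay => enorm (f s)) !=set0).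
  by apply: ge_sup => [|_ [s _ <-]//]; exists x.
by rewrite /history_norm e0 sup0.
Qed.

Lemma history_norm_ge0 (f : history) : 0 <= history_norm f.
Proof.
have [[_ [s _ _]]|/nonemptyPn e0] :=
  pselect (range (fun s : delay => enorm (f s)) !=set0).
  exact: le_trans (enorm_ge0 _) (le_history_norm f s).
by rewrite /history_norm e0 sup0.
Qed.

Lemma ler_history_normD (f g : history) :
  history_norm (f + g) <= history_norm f + history_norm g.
Proof.
apply: history_norm_le => [|s]; first by rewrite addr_ge0 ?history_norm_ge0.
apply: le_trans (ler_enormD (f s) (g s)) _.
by rewrite lerD ?le_history_norm.
Qed.

Lemma history_normZ (a : R) (f : history) :
  history_norm (a *: f) = `|a| * history_norm f.
Proof.
have le_normZ b (g : history) : history_norm (b *: g) <= `|b| * history_norm g.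
  apply: history_norm_le => [|s].
    by rewrite mulr_ge0 ?history_norm_ge0.
  by rewrite [leLHS](enormZ b (g s)) ler_wpM2l ?le_history_norm.
apply/eqP; rewrite eq_le le_normZ/=.
have [->|a0] := eqVneq a 0; first by rewrite normr0 mul0r history_norm_ge0.
rewrite -ler_pdivlMl ?normr_gt0//.
by have := le_normZ a^-1 (a *: f); rewrite scalerA mulVf// scale1r normfV.
Qed.

Lemma history_norm0_eq0 (f : history) : history_norm f = 0 -> f = 0.
Proof.
move=> f0; apply/continuousEP => s.
by apply/enorm0_eq0/eqP; rewrite eq_le enorm_ge0 -f0 le_history_norm.
Qed.

HB.instance Definition _ := @Lmodule_isNormed.Build R history
  history_norm ler_history_normD history_normZ history_norm0_eq0.

(* The Borel sigma-algebra of the sup norm. *)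
HB.instance Definition _ := @isMeasurable.Build
  (sigma_display (@open history)) history
  <<s (@open history) >> (@sigma_algebra0 _ setT _)
  (@sigma_algebraC _ _) (@sigma_algebra_bigcup _ setT _).

End history.
Arguments history {R} d tau.
Arguments history_norm {R d tau} f.

Lemma history_normE (R : realType) (d : nat) (tau : R) (f : history d tau) :
  `|f| = sup (range (fun s : delay tau => enorm (f s))).
Proof. by []. Qed.

Lemma history_measurableE (R : realType) (d : nat) (tau : R) :
  (measurable : set (set (history d tau))) = <<s open >>.
Proof. by []. Qed.

Section law.
Context {R : realType} d1 d2 (Omega : measurableType d1) (T : measurableType d2).

(* Equality of [mu] with the push-forward of [P] is only required on measurable
   sets, since a [probability] is a function on all sets. *)
Definition has_law (P : probability Omega R) (Z : Omega -> T)
    (mu : probability T R) : Prop :=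
  measurable_fun setT Z /\ forall A, measurable A -> mu A = P (Z @^-1` A).

End law.

Definition vec_integral (R : realType) (d : nat) dT (T : measurableType dT)
    (mu : {measure set T -> \bar R}) (D : set T) (f : T -> 'rV[R]_d) :
    'rV[R]_d :=
  \row_(i < d) (\int[mu]_(x in D) f x 0 i).

Section measures_on_histories.
Context {R : realType} {d : nat} {tau : R}.
Local Notation E := (history d tau).
Implicit Types mu nu : probability E R.

Definition supported_in_ball mu (R0 : R) : Prop :=
  mu (~` [set sigma : E | `|sigma| <= R0]) = 0%E.

Definition finite_first_moment mu : Prop :=
  (\int[mu]_sigma (`|sigma|)%:E < +oo)%E.

Definition W1 mu nu : \bar R :=
  ereal_sup [set (\int[mu]_sigma (phi sigma)%:E -
                  \int[nu]_sigma (phi sigma)%:E)%E |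
    phi in [set phi : E -> R |
      forall sigma sigma', `|phi sigma - phi sigma'| <= `|sigma - sigma'|]].

Definition P1_continuous_curve (mu : R -> probability E R) : Prop :=
  (forall t, 0 <= t -> finite_first_moment (mu t)) /\
  (forall t, 0 <= t ->
    W1 (mu s) (mu t) @[s --> within `[0, +oo[ (nbhs t)] --> 0%E).

Definition mean_field (K : 'rV[R]_d -> E -> 'rV[R]_d)
    (mu : R -> probability E R) (t : R) (x : 'rV[R]_d) : 'rV[R]_d :=
  vec_integral (mu t) setT (K x).

End measures_on_histories.

(* Value at a real time, with 0 as default value outside [-tau, 0]. *)
Definition history_at (R : realType) (d : nat) (tau : R)
    (sigma : history d tau) (s : R) : 'rV[R]_d :=
  valL_ 0 sigma s.

Lemma history_atE (R : realType) (d : nat) (tau : R) (sigma : history d tau)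
  (s : delay tau) : history_at sigma (val s) = sigma s.
Proof. exact: (congr1 (@^~ s) (valLK 0 (sigma : delay tau -> _))). Qed.

(* [segment d tau x t] is x_t. The default value 0 is returned only if
   s |-> x (t + s) is not continuous on [-tau, 0], which does not happen for
   t >= 0 and x continuous on [-tau, +oo[. *)
Definition segment (R : realType) (d : nat) (tau : R) (x : R -> 'rV[R]_d)
    (t : R) : history d tau :=
  insubd (0 : history d tau) (fun s : delay tau => x (t + val s)).

Lemma segmentE (R : realType) (d : nat) (tau : R) (x : R -> 'rV[R]_d) (t : R) :
  {within `[- tau, +oo[, continuous x} -> 0 <= t ->
  forall s : delay tau, segment tau x t s = x (t + val s).
Proof.
move=> /subspace_sigL_continuousP cx t0 s.
have dom (u : delay tau) : t + val u \in (`[- tau, +oo[%classic : set R).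
  have := set_valP u; rewrite /= in_itv/= => /andP[tu _].
  by rewrite inE/= in_itv/= andbT (le_trans tu)// lerDr.
pose j (u : delay tau) : (`[- tau, +oo[%classic : set R) :=
  exist _ (t + val u) (dom u).
have cj : continuous j.
  apply: continuous_comp_initial => u.
  have cv : {for u, continuous (val : delay tau -> R)}.
    exact: initial_continuous.
  have ct : {for u, continuous (cst t : delay tau -> R)}.
    exact: cst_continuous.
  by have := continuousD ct cv.
have cxt : continuous (fun u : delay tau => x (t + val u)).
  by move=> u; exact: (continuous_comp (cj u) (cx (j u))).
have xP : (fun u : delay tau => x (t + val u)) \in @is_history R d tau.
  exact/asboolP.
exact: (congr1 (@^~ s) (insubdK (0 : history d tau) xP)).
Qed.

(* [X] is a process on [Omega] with law curve t |-> L(X_t) given by [mu]; its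
   values at times < -tau, and those of [mu] at times < 0, are irrelevant. *)
Record pathwise_solution (R : realType) (d : nat) (tau : R)
    (K : 'rV[R]_d -> history d tau -> 'rV[R]_d)
    dO (Omega : measurableType dO) (P : probability Omega R)
    (X0 : Omega -> history d tau) (X : Omega -> R -> 'rV[R]_d)
    (mu : R -> probability (history d tau) R) : Prop := PathwiseSolution {
  sol_continuous : forall w, {within `[- tau, +oo[, continuous (X w)} ;
  sol_law : forall t, 0 <= t ->
    has_law P (fun w => segment tau (X w) t) (mu t) ;
  sol_curve : P1_continuous_curve mu ;
  sol_equation : {ae P, forall w,
    (forall t, 0 <= t -> X w t = history_at (X0 w) 0 +
       vec_integral lebesgue_measure `[0, t]
         (fun s => mean_field K mu s (X w s))) /\
    (forall t, - tau <= t <= 0 -> X w t = history_at (X0 w) t)}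
}.

(* Main.v *)
Require Import Defs.
From HB Require Import structures.
From mathcomp Require Import all_boot all_order all_algebra.
From mathcomp Require Import all_classical all_reals all_analysis.
From mathcomp Require Import measurable_realfun.
From mathcomp Require Import ring lra.
Import Order.TTheory GRing.Theory Num.Theory.
Import numFieldNormedType.Exports.
Local Open Scope classical_set_scope.
Local Open Scope ring_scope.

(** The equation is an ordinary differential equation for each sample path,
    coupled to the others only through the curve of laws mu, and the mean field
    is Lipschitz in the position and in the law:
      |F[mu](t,x) - F[nu](t,y)| <= L (|x - y| + W1 (mu t) (nu t))
    ([mean_field_lipschitz]), since K paired with a vector is a Lipschitz test
    function.

    Stability. Let X and Y be solutions with laws mu and nu. Gronwall's
    inequality ([gronwall]) applied to any two good sample paths w and w' bounds
    |X_t(w) - Y_t(w')| by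
      exp(L t) (|X_0(w) - Y_0(w')| + L int_0^t W1 (mu s) (nu s) ds)
    ([delay_solution_dist]). Given a 1-Lipschitz test function phi, the function
      psi(s) = inf over w' of phi(Y_t(w')) + exp(L t) |s - Y_0(w')|
    is exp(L t)-Lipschitz, at most phi(Y_t) at Y_0, and at least phi(X_t) minus
    exp(L t) L int_0^t W1 (mu s) (nu s) ds at X_0. Testing the initial laws
    against psi therefore bounds W1 (mu t) (nu t) by
      exp(L t) (W1 (mu 0) (nu 0) + L int_0^t W1 (mu s) (nu s) ds)
    ([w1_comparison], [w1_integral_inequality]); this is the dual counterpart of
    pushing an optimal coupling along the solutions. A second use of Gronwall's
    inequality gives r(t) = exp(L t) exp(exp(L t) L t) ([w1_stability]).
    Equal initial variables thus have solutions with equal laws, and the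
    pathwise bound then makes them equal almost surely ([pathwise_uniqueness]).

    Existence. The law of the solution is the image of the initial law mu0 under
    the flow sigma |-> Z sigma that solves the equation from each deterministic
    history sigma. In terms of Z the problem is a fixed point problem between
    continuous functions of time:
      Z sigma t = sigma(0)
                  + int_0^t int_E K (Z sigma s, (Z sigma')_s) mu0(dsigma') ds.
    The right-hand side contracts by the factor 1/2 for the weight
    (1 + |sigma|) exp(rate t) ([picard_contraction]), so its iterates converge
    geometrically and uniformly enough for the limit to be a fixed flow
    ([picard_fixpoint]). Continuity of the curve of laws follows by dominated
    convergence ([segment_gap_continuous]). *)

Set Implicit Arguments.
Unset Strict Implicit.
Unset Printing Implicit Defensive.

(** * Euclidean norm and vector-valued integrals *)

Section euclidean.
Context {R : realType} {d : nat}.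
Implicit Types x y z : 'rV[R]_d.

Lemma enorm0 : enorm (0 : 'rV[R]_d) = 0.
Proof. by rewrite -(scale0r (0 : 'rV[R]_d)) enormZ normr0 mul0r. Qed.

Lemma enormN x : enorm (- x) = enorm x.
Proof. by rewrite -scaleN1r enormZ normrN1 mul1r. Qed.

Lemma enormBC x y : enorm (x - y) = enorm (y - x).
Proof. by rewrite -enormN opprB. Qed.

Lemma ler_enorm_distD y x z : enorm (x - z) <= enorm (x - y) + enorm (y - z).
Proof. by apply: le_trans (ler_enormD _ _); rewrite addrA subrK. Qed.

Lemma enorm_le_distD x y : enorm x <= enorm y + enorm (x - y).
Proof. by apply: le_trans (ler_enormD _ _); rewrite addrC subrK. Qed.

Lemma coord_le_enorm x i : `|x 0 i| <= enorm x.
Proof.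
rewrite -sqrtr_sqr ler_wsqrtr// (bigD1 i)//= lerDl.
by apply: sumr_ge0 => j _; exact: sqr_ge0.
Qed.

Lemma normr_le_enorm x : `|x| <= enorm x.
Proof.
have [->|x0] := eqVneq x 0; first by rewrite normr0 enorm_ge0.
rewrite /Num.norm/=; have [|[i j] ->] := @mx_norm_neq0 _ _ _ x.
  by apply: contra_neq x0; exact: mx_norm_eq0.
by rewrite /= (ord1 i) coord_le_enorm.
Qed.

Lemma enorm_le_sum x : enorm x <= \sum_(i < d) `|x 0 i|.
Proof.
rewrite -(@ler_pXn2r _ 2)// ?nnegrE ?enorm_ge0 ?sumr_ge0//.
rewrite enorm_sqr expr2 mulr_suml ler_sum// => i _.
rewrite -real_normK ?num_real// expr2 ler_wpM2l//.
by rewrite (bigD1 i)//= lerDl sumr_ge0.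
Qed.

(** The max norm, which defines the topology, is bounded by the Euclidean
    norm, and the Euclidean norm is continuous; hence both define the same
    convergence. *)
Lemma cvg_enormP (T : Type) (F : set_system T) {FF : Filter F}
    (f : T -> 'rV[R]_d) (l : 'rV[R]_d) :
  (forall e, 0 < e -> \forall t \near F, enorm (f t - l) < e) <-> f @ F --> l.
Proof.
split=> [fl|fl].
  apply/cvgrPdist_lt => e /fl; apply: filterS => t.
  by rewrite distrC; apply: le_lt_trans; exact: normr_le_enorm.
have : enorm (f t - l) @[t --> F] --> enorm (l - l).
  apply: (@cvg_comp _ _ _ (fun t => f t - l) (@enorm R d)); last first.
    exact: enorm_continuous.
  by apply: cvgB => //; exact: cvg_cst.
move=> + e e0; rewrite subrr enorm0 => /cvgrPdist_lt/(_ e e0).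
by apply: filterS => t; rewrite sub0r normrN ger0_norm// enorm_ge0.
Qed.

End euclidean.

Section real_integrable.
Context {R : realType} dT (T : measurableType dT).
Variables (mu : {measure set T -> \bar R}) (D : set T).
Hypothesis mD : measurable D.
Implicit Types f g : T -> R.

Lemma integrableZ_EFin r f : mu.-integrable D (EFin \o f) ->
  mu.-integrable D (EFin \o (fun x => r * f x)).
Proof. exact: integrableZl. Qed.

Lemma integrableD_EFin f g : mu.-integrable D (EFin \o f) ->
  mu.-integrable D (EFin \o g) ->
  mu.-integrable D (EFin \o (fun x => f x + g x)).
Proof. exact: integrableD. Qed.

Lemma integrableB_EFin f g : mu.-integrable D (EFin \o f) ->
  mu.-integrable D (EFin \o g) ->
  mu.-integrable D (EFin \o (fun x => f x - g x)).
Proof. exact: integrableB. Qed.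

End real_integrable.

Section vector_integral.
Context {R : realType} {d : nat} dT (T : measurableType dT).
Variables (mu : {measure set T -> \bar R}) (D : set T).
Hypothesis mD : measurable D.
Implicit Types (f g : T -> 'rV[R]_d) (v : 'rV[R]_d) (h : T -> R).

Definition coord_integrable f :=
  forall i, mu.-integrable D (EFin \o (fun x => f x 0 i)).

(** Fixed vectors can be paired with an integral under the integral sign,
    which reduces Euclidean bounds on vector-valued integrals to real
    integrals. *)
Lemma integrable_dot v f : coord_integrable f ->
  mu.-integrable D (EFin \o (fun x => \sum_(i < d) v 0 i * f x 0 i)) /\
  \int[mu]_(x in D) (\sum_(i < d) v 0 i * f x 0 i) =
  \sum_(i < d) v 0 i * vec_integral mu D f 0 i.
Proof.
move=> fi.
have vfi i : mu.-integrable D (EFin \o (fun x => v 0 i * f x 0 i)).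
  exact: integrableZ_EFin.
under [RHS]eq_bigr do rewrite mxE -RintegralZl//.
rewrite /index_enum; elim: (Finite.enum _) => [|i s [IHi IHe]].
  split; first by under eq_fun do rewrite big_nil; exact: integrable0.
  by under eq_Rintegral do rewrite big_nil; rewrite big_nil Rintegral_cst// mul0r.
split.
  under eq_fun do rewrite big_cons.
  exact: integrableD_EFin.
under eq_Rintegral do rewrite big_cons.
by rewrite RintegralD// IHe big_cons.
Qed.

(** With v the integral of f, one has |v|^2 = int <v, f> <= |v| int h by
    Cauchy-Schwarz, so the bound holds without a dimensional constant. *)
Lemma enorm_vec_integral f h : coord_integrable f ->
  mu.-integrable D (EFin \o h) -> (forall x, D x -> enorm (f x) <= h x) ->
  enorm (vec_integral mu D f) <= \int[mu]_(x in D) h x.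
Proof.
move=> fi hi fh; set v := vec_integral mu D f.
have [v0|v0] := eqVneq (enorm v) 0.
  rewrite v0; apply: Rintegral_ge0 => x /fh; exact/le_trans/enorm_ge0.
have vp : 0 < enorm v by rewrite lt_neqAle eq_sym v0 enorm_ge0.
rewrite -(ler_pM2l vp) -expr2 enorm_sqr -RintegralZl//.
have [dfi dfE] := integrable_dot v fi.
under eq_bigr do rewrite expr2.
rewrite -dfE; apply: le_Rintegral => //.
  exact: integrableZ_EFin.
move=> x Dx; apply: le_trans (enorm_cauchy_schwarz _ _) _.
by rewrite ler_wpM2l ?enorm_ge0// fh.
Qed.

Lemma vec_integralB f g : coord_integrable f -> coord_integrable g ->
  vec_integral mu D (fun x => f x - g x) =
  vec_integral mu D f - vec_integral mu D g.
Proof.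
move=> fi gi; apply/rowP => i; rewrite !mxE -RintegralB//.
by apply: eq_Rintegral => x _; rewrite !mxE.
Qed.

Lemma coord_integrableB f g : coord_integrable f -> coord_integrable g ->
  coord_integrable (fun x => f x - g x).
Proof.
move=> fi gi i.
under eq_fun do rewrite !mxE.
exact: integrableB_EFin.
Qed.

Lemma enorm_vec_integralB f g h : coord_integrable f -> coord_integrable g ->
  mu.-integrable D (EFin \o h) ->
  (forall x, D x -> enorm (f x - g x) <= h x) ->
  enorm (vec_integral mu D f - vec_integral mu D g) <= \int[mu]_(x in D) h x.
Proof.
move=> fi gi hi fgh; rewrite -vec_integralB//.
by apply: enorm_vec_integral => //; exact: coord_integrableB.
Qed.

End vector_integral.

(** * Integrals in time and Gronwall's inequality *)

Section time_integrals.
Context {R : realType}.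
Notation leb := (@lebesgue_measure R).
Implicit Types (f g u : R -> R) (a b c t T : R).

Lemma within_continuous_integrable f a b :
  {within `[a, b], continuous f} -> leb.-integrable `[a, b] (EFin \o f).
Proof.
by move=> cf; apply: continuous_compact_integrable => //; exact: segment_compact.
Qed.

Lemma within_continuousS f t T : t <= T ->
  {within `[0, T], continuous f} -> {within `[0, t], continuous f}.
Proof.
move=> tT; apply: continuous_subspaceW => x /=; rewrite !in_itv/= => /andP[-> xt].
exact: le_trans tT.
Qed.

Lemma within_continuousSy f (T : R) :
  {within `[0, +oo[, continuous f} -> {within `[0, T], continuous f}.
Proof.
by apply: continuous_subspaceW => x /=; rewrite !in_itv/= => /andP[->].
Qed.

Lemma Rintegral_expR b t : 0 <= t ->
  \int[leb]_(s in `[0, t]) (b * expR (b * s)) = expR (b * t) - 1.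
Proof.
rewrite le_eqVlt => /predU1P[<-|t0].
  by rewrite set_itv1 Rintegral_set1 mulr0 expR0 subrr.
have dF (x : R) : is_derive x 1 (fun s : R => expR (b * s)) (b * expR (b * x)).
  by apply: is_derive_eq; rewrite mulrC; congr (_ * _); exact: mulr1.
have cF : continuous (fun s => expR (b * s)).
  move=> x; apply/differentiable_continuous/derivable1_diffP.
  by have [] := dF x.
rewrite /Rintegral (@continuous_FTC2 _ _ (fun s => expR (b * s)))//=.
- by rewrite mulr0 expR0.
- apply: continuous_subspaceT => x; apply: cvgMr => //; exact: cF.
- split.
  + by move=> x _; have [] := dF x.
  + exact/cvg_at_right_filter/cF.
  + exact/cvg_at_left_filter/cF.
- by move=> x _; rewrite derive1E derive_val.
Qed.

(** Let m maximize u(s) exp(-b s) on [0, T], and let M be the maximum.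
    Bounding u(s) by M exp(b s) under the integral, the hypothesis at m reads
    M exp(b m) <= a + M (exp(b m) - 1), that is M <= a. *)
Lemma gronwall u a b T : 0 <= b -> {within `[0, T], continuous u} ->
  (forall t, 0 <= t <= T -> u t <= a + b * \int[leb]_(s in `[0, t]) u s) ->
  forall t, 0 <= t <= T -> u t <= a * expR (b * t).
Proof.
move=> b0 cu ub.
have cE c : {within `[0, T], continuous (fun s => expR (c * s))}.
  apply: continuous_subspaceT => x.
  apply: (@continuous_comp _ _ _ (fun s => c * s) expR).
    by apply: cvgMr => //; exact: cvg_id.
  exact: continuous_expR.
move=> t /andP[t0 tT]; have T0 := le_trans t0 tT.
have : {within `[0, T], continuous (fun s => u s * expR (- b * s))}.
  by move=> x; apply: cvgM; [exact: cu|exact: cE].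
move=> /(EVT_max T0)[m]; rewrite in_itv/= => /andP[m0 mT] mmax.
set M := u m * expR (- b * m) in mmax.
have uM s : 0 <= s <= T -> u s <= M * expR (b * s).
  move=> sT; have := mmax s; rewrite in_itv/= => /(_ sT).
  by rewrite mulNr expRN ler_pdivrMr ?expR_gt0.
suff Ma : M <= a.
  by rewrite (le_trans (uM _ _)) ?t0// ler_wpM2r ?expR_ge0.
have um : u m = M * expR (b * m).
  by rewrite /M mulNr expRN mulfVK// gt_eqF// expR_gt0.
have : u m <= a + M * (expR (b * m) - 1).
  apply: le_trans (ub _ _) _; first by rewrite m0.
  have iu : leb.-integrable `[0, m] (EFin \o u).
    exact/within_continuous_integrable/(within_continuousS mT).
  have iE : leb.-integrable `[0, m] (EFin \o (fun s => b * expR (b * s))).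
    apply: integrableZ_EFin => //.
    exact/within_continuous_integrable/(within_continuousS mT).
  rewrite lerD2l -(Rintegral_expR b m0) -!RintegralZl//.
  apply: le_Rintegral => //; [exact: integrableZ_EFin|exact: integrableZ_EFin|].
  move=> s /=; rewrite in_itv/= => /andP[s0 sm].
  by rewrite mulrCA ler_wpM2l// uM// s0 (le_trans sm).
by rewrite um mulrBr mulr1 addrCA -[leLHS]addr0 lerD2l subr_ge0.
Qed.

Lemma ge0_Rintegral_itvS f t T : 0 <= t <= T ->
  {within `[0, T], continuous f} -> (forall s, 0 <= s <= T -> 0 <= f s) ->
  \int[leb]_(s in `[0, t]) f s <= \int[leb]_(s in `[0, T]) f s.
Proof.
move=> /andP[t0 tT] cf f0.
have iT := within_continuous_integrable cf.
have it := within_continuous_integrable (within_continuousS tT cf).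
rewrite /Rintegral fine_le//; [exact: integrable_fin_num|exact: integrable_fin_num|].
apply: ge0_subset_integral => //.
- by have /integrableP[] := iT.
- by move=> s /=; rewrite !in_itv/= => /andP[-> /le_trans]; exact.
Qed.

Lemma continuous_primitive f : continuous f ->
  continuous (fun t => \int[leb]_(s in `[0, t]) f s).
Proof.
move=> cf.
rewrite (_ : (fun t => _) = fun t => \int[leb]_(s in `[0, Num.max t 0]) f s).
  move=> t0; pose b := Num.max t0 0 + 1.
  have cF : {within `[0, b], continuous (fun t => \int[leb]_(s in `[0, t]) f s)}.
    apply: parameterized_integral_continuous.
      by rewrite addr_ge0// le_max lexx orbT.
    exact/within_continuous_integrable/continuous_subspaceT.
  have b0 : `[0, b]%classic (Num.max t0 0).
    by rewrite /= in_itv/= le_max lexx orbT/= lerDl.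
  move/subspace_continuousP : cF => /(_ _ b0); apply: cvg_comp => A.
  have cm : Num.max t (0 : R) @[t --> t0] --> Num.max t0 0.
    exact: (@continuous_max _ _ _ _ _ (@cvg_id _ _) (@cvg_cst _ _ _ _ _)).
  have m0 (x : R) : 0 <= Num.max x 0 by rewrite le_max lexx orbT.
  have h : \forall t \near t0, `[0, b]%classic (Num.max t 0).
    have : t0 < b by rewrite /b ltr_pwDr// le_max lexx.
    move=> /lt_nbhsl; apply: filterS => t tb; rewrite /= in_itv/= m0/=.
    by rewrite ge_max ltW//= /b addr_ge0.
  by rewrite /within /= => /cm nA; apply: (filterS2 _ _ nA h) => t; exact.
apply/funext => t; have [t0|//] := ltP t 0.
rewrite set_itv1 Rintegral_set1 set_itv_ge ?Rintegral_set0//.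
by rewrite bnd_simp -ltNge.
Qed.

End time_integrals.

(** * Laws, Lipschitz test functions and the dual distance *)

Section laws.
Context {R : realType} d1 d2 (Omega : measurableType d1) (T : measurableType d2).
Variable P : probability Omega R.

Definition image_law (Z : Omega -> T) (mZ : measurable_fun setT Z) :
    probability T R :=
  distribution P (HB.pack_for {mfun Omega >-> T} Z
    (isMeasurableFun.Build _ _ _ _ _ mZ)).

Lemma has_law_image (Z : Omega -> T) (mZ : measurable_fun setT Z) :
  has_law P Z (image_law mZ).
Proof. by split. Qed.

Variables (Z : Omega -> T) (mu : probability T R).
Hypothesis Zmu : has_law P Z mu.

Let mZ : measurable_fun setT Z := Zmu.1.

Let integral_image (f : T -> \bar R) :
  (\int[mu]_x f x = \int[image_law mZ]_x f x)%E.
Proof. by apply: eq_measure_integral => A mA _; exact: Zmu.2. Qed.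

Lemma has_law_ge0_integral (f : T -> \bar R) : measurable_fun [set: T] f ->
  (forall x, 0 <= f x)%E -> (\int[mu]_x f x = \int[P]_w f (Z w))%E.
Proof.
by move=> mf f0; rewrite integral_image ge0_integral_distribution.
Qed.

Lemma has_law_integrable (f : T -> R) : measurable_fun [set: T] f ->
  mu.-integrable setT (EFin \o f) -> P.-integrable setT (EFin \o (f \o Z)).
Proof.
move=> mf /integrableP[_ fi]; apply/integrableP; split.
  by apply/measurable_EFinP; exact: measurableT_comp.
move: fi; rewrite has_law_ge0_integral//.
by apply: measurableT_comp => //; exact/measurable_EFinP.
Qed.

Lemma has_law_Rintegral (f : T -> R) : measurable_fun [set: T] f ->
  mu.-integrable setT (EFin \o f) -> \int[mu]_x f x = \int[P]_w f (Z w).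
Proof.
move=> mf fi; rewrite /Rintegral integral_image integral_distribution//=.
  exact/measurable_EFinP.
exact: has_law_integrable.
Qed.

End laws.

Section lipschitz_functions.
Context {R : realType} {d : nat} {tau : R}.
Local Notation E := (history d tau).
Implicit Types (mu nu : probability E R) (phi : E -> R) (l : R).

Lemma continuous_history_measurable phi : continuous phi ->
  measurable_fun setT phi.
Proof.
move=> /continuousP cf; apply: (measurability _ (RGenOpens.measurableE R)).
move=> _ [_ [a [b ->]] <-]; rewrite setTI.
by apply: sub_sigma_algebra; apply: cf; exact: interval_open.
Qed.

Lemma continuous_history_measurableE (f : E -> E) : continuous f ->
  measurable_fun setT f.
Proof.
move=> /continuousP cf; apply: (measurability (@open E)) => //.
move=> _ [A oA <-]; rewrite setTI.
by apply: sub_sigma_algebra; exact: cf.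
Qed.

Definition history_lipschitz l phi :=
  forall sigma sigma' : E, `|phi sigma - phi sigma'| <= l * `|sigma - sigma'|.

Lemma history_lipschitz_continuous l phi : history_lipschitz l phi ->
  continuous phi.
Proof.
move=> lphi s.
have l0 : 0 < `|l| + 1 by rewrite ltr_wpDl.
apply: (iffRL (@cvgrPdist_lt _ _ _ _ (nbhs_filter s) phi (phi s))) => e e0.
have /(@cvgrPdist_lt _ E _ _ (nbhs_filter s) id s) hs :
  s' @[s' --> s] --> s by exact: cvg_id.
have /hs : 0 < e / (`|l| + 1) by exact: divr_gt0.
apply: filterS => s'; rewrite ltr_pdivlMr// mulrC; apply: le_lt_trans.
apply: le_trans (lphi _ _) _.
by rewrite ler_wpM2r// (le_trans (ler_norm _))// lerDl.
Qed.

Lemma history_lipschitz_measurable l phi : history_lipschitz l phi ->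
  measurable_fun setT phi.
Proof.
move=> /history_lipschitz_continuous; exact: continuous_history_measurable.
Qed.

Lemma history_norm_lipschitz : history_lipschitz 1 (fun s : E => `|s|).
Proof. by move=> s s'; rewrite mul1r; exact: ler_dist_dist. Qed.

Lemma integrable_history_norm mu : finite_first_moment mu ->
  mu.-integrable setT (EFin \o (fun s : E => `|s|)).
Proof.
move=> mu1; apply/integrableP; split.
  by apply/measurable_EFinP; exact: history_lipschitz_measurable history_norm_lipschitz.
by under eq_integral do rewrite /= normr_id.
Qed.

Lemma history_lipschitz_integrable mu l phi : finite_first_moment mu ->
  history_lipschitz l phi -> mu.-integrable setT (EFin \o phi).
Proof.
move=> mu1 lphi.
apply: (@le_integrable _ _ _ _ _ measurableT _
  (EFin \o (fun s : E => `|phi 0| + l * `|s|))).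
- by apply/measurable_EFinP; exact: history_lipschitz_measurable lphi.
- move=> s _; rewrite /= lee_fin [leRHS]ger0_norm.
    rewrite -[X in l * `|X|]subr0 (le_trans _ (lerD (lexx _) (lphi s 0)))//.
    by rewrite -{1}(subrK (phi 0) (phi s)) addrC ler_normD.
  by rewrite addr_ge0// -[X in l * `|X|]subr0 (le_trans _ (lphi s 0)).
- apply: integrableD_EFin => //.
    exact: finite_measure_integrable_cst.
  by apply: integrableZ_EFin => //; exact: integrable_history_norm.
Qed.

End lipschitz_functions.

Section wasserstein.
Context {R : realType} {d : nat} {tau : R}.
Local Notation E := (history d tau).
Implicit Types (mu nu rho : probability E R) (phi : E -> R) (l c : R).

(** The real-valued distance; no information is lost between laws with finite
    first moments, by [w1E]. *)
Definition w1 mu nu : R := fine (W1 mu nu).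

Lemma Rintegral_probability_cst mu c : \int[mu]_(s in setT) c = c.
Proof. by rewrite Rintegral_cst//= probability_setT mulr1. Qed.

Lemma EFin_Rintegral mu phi : mu.-integrable setT (EFin \o phi) ->
  (\int[mu]_s (phi s)%:E = (\int[mu]_s phi s)%:E)%E.
Proof. by move=> iphi; rewrite /Rintegral fineK//; exact: integrable_fin_num. Qed.

Lemma W1_le mu nu c : finite_first_moment mu -> finite_first_moment nu ->
  (forall phi, history_lipschitz 1 phi ->
     \int[mu]_s phi s - \int[nu]_s phi s <= c) ->
  (W1 mu nu <= c%:E)%E.
Proof.
move=> mu1 nu1 h; apply: ge_ereal_sup => _ [phi lphi <-].
have lp : history_lipschitz 1 phi by move=> s s'; rewrite mul1r; exact: lphi.
rewrite !EFin_Rintegral; [|exact: history_lipschitz_integrable lp..].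
by rewrite -EFinB lee_fin; exact: h.
Qed.

Lemma W1_ge mu nu phi : finite_first_moment mu -> finite_first_moment nu ->
  history_lipschitz 1 phi ->
  ((\int[mu]_s phi s - \int[nu]_s phi s)%:E <= W1 mu nu)%E.
Proof.
move=> mu1 nu1 lp; apply: ereal_sup_ubound; exists phi.
  by move=> s s'; have := lp s s'; rewrite mul1r.
by rewrite !EFin_Rintegral; [|exact: history_lipschitz_integrable lp..].
Qed.

Lemma W1_ge0 mu nu : finite_first_moment mu -> finite_first_moment nu ->
  (0 <= W1 mu nu)%E.
Proof.
move=> mu1 nu1; have : history_lipschitz 1 (fun _ : E => 0).
  by move=> s s'; rewrite subrr normr0 mul1r.
by move=> /(W1_ge mu1 nu1); rewrite !Rintegral_probability_cst subrr.
Qed.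

Lemma w1_ge0 mu nu : finite_first_moment mu -> finite_first_moment nu ->
  0 <= w1 mu nu.
Proof. by move=> mu1 nu1; rewrite fine_ge0// W1_ge0. Qed.

(** A Lipschitz test function may be recentred at the zero history, where it
    is dominated by the norm: the distance is at most the sum of the first
    moments. *)
Lemma W1_fin_num mu nu : finite_first_moment mu -> finite_first_moment nu ->
  W1 mu nu \is a fin_num.
Proof.
move=> mu1 nu1; rewrite ge0_fin_numE ?W1_ge0//.
apply: (@le_lt_trans _ _ (\int[mu]_s `|s| + \int[nu]_s `|s|)%:E).
  2: exact: ltry.
apply: W1_le => // phi lp.
have imu := history_lipschitz_integrable mu1 lp.
have inu := history_lipschitz_integrable nu1 lp.
have nmu := integrable_history_norm mu1.
have nnu := integrable_history_norm nu1.
have cmu := finite_measure_integrable_cst mu (phi 0) measurableT.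
have cnu := finite_measure_integrable_cst nu (phi 0) measurableT.
have h1 : \int[mu]_s phi s - phi 0 <= \int[mu]_s `|s|.
  rewrite -[X in _ - X](Rintegral_probability_cst mu) -RintegralB//.
  apply: le_Rintegral => //; first exact: integrableB_EFin.
  move=> s _; apply: le_trans (ler_norm _) _.
  by have := lp s 0; rewrite subr0 mul1r.
have h2 : phi 0 - \int[nu]_s phi s <= \int[nu]_s `|s|.
  rewrite -[X in X - _](Rintegral_probability_cst nu) -RintegralB//.
  apply: le_Rintegral => //; first exact: integrableB_EFin.
  move=> s _; apply: le_trans (ler_norm _) _.
  by have := lp 0 s; rewrite sub0r normrN mul1r.
by have := lerD h1 h2; rewrite addrA subrK.
Qed.

Lemma w1E mu nu : finite_first_moment mu -> finite_first_moment nu ->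
  (w1 mu nu)%:E = W1 mu nu.
Proof. by move=> mu1 nu1; rewrite fineK// W1_fin_num. Qed.

Lemma w1_le mu nu c : finite_first_moment mu -> finite_first_moment nu ->
  (forall phi, history_lipschitz 1 phi ->
     \int[mu]_s phi s - \int[nu]_s phi s <= c) ->
  w1 mu nu <= c.
Proof. by move=> mu1 nu1 h; rewrite -lee_fin w1E//; exact: W1_le. Qed.

Lemma w1_ge mu nu l phi : finite_first_moment mu -> finite_first_moment nu ->
  0 < l -> history_lipschitz l phi ->
  \int[mu]_s phi s - \int[nu]_s phi s <= l * w1 mu nu.
Proof.
move=> mu1 nu1 l0 lp.
have lp1 : history_lipschitz 1 (fun s => l^-1 * phi s).
  move=> s s'; rewrite mul1r -mulrBr normrM normfV (gtr0_norm l0).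
  by rewrite ler_pdivrMl.
have := W1_ge mu1 nu1 lp1.
rewrite -w1E// lee_fin !RintegralZl//; [|exact: history_lipschitz_integrable lp..].
by rewrite -mulrBr ler_pdivrMl.
Qed.

Lemma w1_refl mu : finite_first_moment mu -> w1 mu mu = 0.
Proof.
move=> mu1; apply/eqP; rewrite eq_le w1_ge0// andbT.
by apply: w1_le => // phi lp; rewrite subrr.
Qed.

Lemma history_lipschitzN l phi : history_lipschitz l phi ->
  history_lipschitz l (fun s => - phi s).
Proof. by move=> lp s s'; rewrite -opprD normrN. Qed.

Lemma w1_sym mu nu : finite_first_moment mu -> finite_first_moment nu ->
  w1 mu nu = w1 nu mu.
Proof.
suff h m n : finite_first_moment m -> finite_first_moment n -> w1 m n <= w1 n m.
  by move=> mu1 nu1; apply/eqP; rewrite eq_le !h.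
move=> m1 n1; apply: w1_le => // phi lp.
have := w1_ge n1 m1 ltr01 (history_lipschitzN lp).
have N (m' : probability E R) : finite_first_moment m' ->
    \int[m']_s (- phi s) = - \int[m']_s phi s.
  move=> m'1; under eq_Rintegral do rewrite -mulN1r.
  by rewrite RintegralZl ?mulN1r//; exact: history_lipschitz_integrable lp.
by rewrite !N// opprK addrC mul1r.
Qed.

Lemma w1_triangle nu mu rho : finite_first_moment mu -> finite_first_moment nu ->
  finite_first_moment rho -> w1 mu rho <= w1 mu nu + w1 nu rho.
Proof.
move=> mu1 nu1 rho1; apply: w1_le => // phi lp.
have h1 := w1_ge mu1 nu1 ltr01 lp.
have h2 := w1_ge nu1 rho1 ltr01 lp.
by have := lerD h1 h2; rewrite !mul1r addrA subrK.
Qed.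

(** By the triangle inequality, the distance of two curves varies by at most
    the sum of their own displacements. *)
Lemma w1_continuous (mu nu : R -> probability E R) :
  P1_continuous_curve mu -> P1_continuous_curve nu ->
  {within `[0, +oo[, continuous (fun t => w1 (mu t) (nu t))}.
Proof.
move=> [mu1 cmu] [nu1 cnu]; apply/subspace_continuousP => t /=.
rewrite in_itv/= andbT => t0.
have c (m : R -> probability E R) e : (forall t, 0 <= t -> finite_first_moment (m t)) ->
    W1 (m s) (m t) @[s --> within `[0, +oo[ (nbhs t)] --> 0%E -> 0 < e ->
    \forall s \near within `[0, +oo[ (nbhs t), w1 (m s) (m t) < e.
  move=> m1 /fine_cvgP[_ /cvgrPdist_lt h] /h; apply: filterS => s.
  by rewrite sub0r normrN; apply: le_lt_trans; exact: ler_norm.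
apply/cvgrPdist_lt => e e0; have e2 : 0 < e / 2 by rewrite divr_gt0.
near=> s.
have s0 : 0 <= s.
  have : `[0, +oo[%classic s by near: s; exact: withinT.
  by rewrite /= in_itv/= andbT.
have hm : w1 (mu s) (mu t) < e / 2.
  by near: s; apply: c => //; exact: cmu.
have hn : w1 (nu s) (nu t) < e / 2.
  by near: s; apply: c => //; exact: cnu.
have := w1_triangle (mu1 _ t0) (mu1 _ s0) (nu1 _ t0).
have := w1_triangle (mu1 _ s0) (nu1 _ s0) (nu1 _ t0).
have := w1_triangle (mu1 _ s0) (mu1 _ t0) (nu1 _ s0).
have := w1_triangle (mu1 _ t0) (nu1 _ t0) (nu1 _ s0).
rewrite (w1_sym (mu1 t t0) (mu1 s s0)) (w1_sym (nu1 t t0) (nu1 s s0)).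
move=> h1 h2 h3 h4; rewrite ltr_norml; apply/andP; split; rewrite /from_subspace; lra.
Unshelve. all: by end_near. Qed.

Lemma supported_in_ball_first_moment mu (R0 : R) : 0 <= R0 ->
  supported_in_ball mu R0 -> finite_first_moment mu.
Proof.
move=> R00 muR0; rewrite /finite_first_moment.
have mn : measurable_fun [set: E] (fun s : E => (`|s|)%:E).
  by apply/measurable_EFinP; exact: history_lipschitz_measurable history_norm_lipschitz.
apply: (@le_lt_trans _ _ (\int[mu]_(s in [set: E]) R0%:E)%E); last first.
  by rewrite integral_cst// [X in (_ * X)%E]probability_setT mule1 ltry.
apply: ae_ge0_le_integral => //.
exists (~` [set s : E | `|s| <= R0]); split => //.
  apply: measurableC; rewrite -[X in measurable X]setTI.
  rewrite (_ : [set s | _] = (fun s : E => `|s|) @^-1` `]-oo, R0]%classic).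
    by apply: (history_lipschitz_measurable history_norm_lipschitz).
  by apply/seteqP; split => s /=; rewrite in_itv.
by move=> s /= h hs; apply: h => _; rewrite lee_fin.
Qed.

End wasserstein.

(** * Comparing distances of image laws *)

Section almost_sure.
Context {R : realType} dO (Omega : measurableType dO) (P : probability Omega R).

Lemma ae_nonempty (G : Omega -> Prop) : {ae P, forall w, G w} -> exists w, G w.
Proof.
move=> [N [mN PN GN]]; apply: contrapT => nG.
have NT : N = setT.
  by apply/seteqP; split => // w _; apply: GN => /= Gw; apply: nG; exists w.
have : P N = 1%E by rewrite NT probability_setT.
by move: PN => -> /eqP; rewrite eq_sym onee_eq0.
Qed.

Lemma ae_le_Rintegral (f g : Omega -> R) : P.-integrable setT (EFin \o f) ->
  P.-integrable setT (EFin \o g) -> {ae P, forall w, f w <= g w} ->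
  \int[P]_w f w <= \int[P]_w g w.
Proof.
move=> fi gi [N [mN PN fgN]].
rewrite /Rintegral (negligible_integral mN)// [in leRHS](negligible_integral mN)//.
have mD : measurable (setT `\` N) by exact: measurableD.
apply: (@le_Rintegral _ _ _ P (setT `\` N)) => //.
- exact: (integrableS measurableT).
- exact: (integrableS measurableT).
- by move=> w [_ Nw]; apply: contrapT => fgw; apply: Nw; exact: fgN.
Qed.

End almost_sure.

Section kantorovich_comparison.
Context {R : realType} {d : nat} {tau : R}.
Local Notation E := (history d tau).
Context dA dB (OA : measurableType dA) (OB : measurableType dB).
Variables (PA : probability OA R) (PB : probability OB R).
Variables (A0 A : OA -> E) (B0 B : OB -> E).
Variables (alpha0 alpha beta0 beta : probability E R).
Hypotheses (A0l : has_law PA A0 alpha0) (Al : has_law PA A alpha).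
Hypotheses (B0l : has_law PB B0 beta0) (Bl : has_law PB B beta).
Hypotheses (alpha01 : finite_first_moment alpha0) (alpha1 : finite_first_moment alpha).
Hypotheses (beta01 : finite_first_moment beta0) (beta1 : finite_first_moment beta).
Variables (GA : OA -> Prop) (GB : OB -> Prop) (l c : R).
Hypotheses (aeA : {ae PA, forall w, GA w}) (aeB : {ae PB, forall w, GB w}).
Hypothesis l0 : 0 < l.
Hypothesis AB : forall w w', GA w -> GB w' ->
  `|A w - B w'| <= l * `|A0 w - B0 w'| + c.

(** The McShane-type extension of [phi \o B] from the sample points of B0: it
    is the largest function below phi (B w) at each B0 w that is l-Lipschitz. *)
Let psi (phi : E -> R) (s : E) : R :=
  inf [set phi (B w) + l * `|s - B0 w| | w in GB].

Section psi.
Variable phi : E -> R.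
Hypothesis lphi : history_lipschitz 1 phi.

Let psi_nonempty s : [set phi (B w) + l * `|s - B0 w| | w in GB] !=set0.
Proof.
have [w Gw] := ae_nonempty aeB.
by exists (phi (B w) + l * `|s - B0 w|); exists w.
Qed.

(** This lower bound makes the infimum finite at every history; at s = A0 w it
    says that the extension loses at most c compared with [phi \o A]. *)
Let psi_lbound w s : GA w ->
  lbound [set phi (B w) + l * `|s - B0 w| | w in GB]
    (phi (A w) - c - l * `|s - A0 w|).
Proof.
have arith (p q m n e f : R) :
    p - q <= m -> m <= n + c -> n <= e + f -> p - c - e <= q + f by lra.
move=> Gw _ [w' Gw' <-].
have h1 := le_trans (ler_norm _) (lphi (A w) (B w')).
have h2 := AB Gw Gw'.
have h3 : l * `|A0 w - B0 w'| <= l * `|s - A0 w| + l * `|s - B0 w'|.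
  rewrite -mulrDr (ler_wpM2l (ltW l0))// -(normrN (s - A0 w)) opprB.
  by apply: le_trans (ler_normD _ _); rewrite addrA subrK.
by rewrite mul1r in h1; exact: arith h1 h2 h3.
Qed.

Let psi_has_lbound s : has_lbound [set phi (B w) + l * `|s - B0 w| | w in GB].
Proof.
have [w Gw] := ae_nonempty aeA.
by eexists; exact: psi_lbound Gw.
Qed.

Let psi_lipschitz : history_lipschitz l (psi phi).
Proof.
have arith (p q m n e : R) : m <= e + n -> p <= q + m -> p - e <= q + n by lra.
suff h s s' : psi phi s - psi phi s' <= l * `|s - s'|.
  by move=> s s'; rewrite ler_norml h andbT lerNl opprB distrC h.
rewrite lerBlDr -lerBlDl; apply: lb_le_inf => // _ [w Gw <-].
have : psi phi s <= phi (B w) + l * `|s - B0 w|.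
  by apply: ge_inf => //; exists w.
have : l * `|s - B0 w| <= l * `|s - s'| + l * `|s' - B0 w|.
  rewrite -mulrDr (ler_wpM2l (ltW l0))//.
  by apply: le_trans (ler_normD _ _); rewrite addrA subrK.
by move=> h1 h2; exact: arith h1 h2.
Qed.

(** The extension lies below [phi \o B] along B0 and above [phi \o A] - c
    along A0, so testing the final laws against phi costs at most c more than
    testing the initial laws against an l-Lipschitz function. *)
Lemma test_function_comparison :
  \int[alpha]_s phi s - \int[beta]_s phi s <= l * w1 alpha0 beta0 + c.
Proof.
have mphi := history_lipschitz_measurable lphi.
have mpsi := history_lipschitz_measurable psi_lipschitz.
have ia := history_lipschitz_integrable alpha1 lphi.
have ib := history_lipschitz_integrable beta1 lphi.
have ia0 := history_lipschitz_integrable alpha01 psi_lipschitz.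
have ib0 := history_lipschitz_integrable beta01 psi_lipschitz.
have h0 := w1_ge alpha01 beta01 l0 psi_lipschitz.
have h1 : \int[alpha]_s phi s <= \int[alpha0]_s psi phi s + c.
  rewrite (has_law_Rintegral Al)// (has_law_Rintegral A0l)//.
  have -> : c = \int[PA]_w c by rewrite Rintegral_cst//= probability_setT mulr1.
  have iA0 := has_law_integrable A0l mpsi ia0.
  have iA := has_law_integrable Al mphi ia.
  have ic := finite_measure_integrable_cst PA c measurableT.
  rewrite -RintegralD//; apply: ae_le_Rintegral => //.
    exact: integrableD_EFin.
  apply: filterS aeA => w Gw; rewrite -lerBlDr.
  have := @psi_lbound w (A0 w) Gw; rewrite subrr normr0 mulr0 subr0.
  exact: lb_le_inf.
have h2 : \int[beta0]_s psi phi s <= \int[beta]_s phi s.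
  rewrite (has_law_Rintegral Bl)// (has_law_Rintegral B0l)//.
  apply: (ae_le_Rintegral (has_law_integrable B0l mpsi ib0)
    (has_law_integrable Bl mphi ib)).
  apply: filterS aeB => w Gw; apply: ge_inf => //.
  by exists w => //; rewrite subrr normr0 mulr0 addr0.
rewrite lerBlDr (le_trans h1)// addrAC lerD2r.
by rewrite -lerBlDr (le_trans _ h0)// lerD2l lerN2.
Qed.

End psi.

(** The dual counterpart of pushing an optimal coupling of the initial laws along
    two processes; the pairs (w, w') range over the product of the two sample
    spaces, as for a coupling. *)
Lemma w1_comparison : w1 alpha beta <= l * w1 alpha0 beta0 + c.
Proof. by apply: w1_le => // phi lphi; exact: test_function_comparison. Qed.

End kantorovich_comparison.

(** * Segments and the mean field *)

Section histories.
Context {R : realType} {d : nat} {tau : R}.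
Local Notation E := (history d tau).

Definition delay_point (s : R) (hs : - tau <= s <= 0) : delay tau :=
  exist _ s (mem_set (hs : s \in `[- tau, 0])).

Lemma history_at_in (sigma : E) (s : R) (hs : - tau <= s <= 0) :
  history_at sigma s = sigma (delay_point hs).
Proof. exact: (history_atE sigma (delay_point hs)). Qed.

Lemma delay_bounds (s : delay tau) : - tau <= val s <= 0.
Proof. by have := set_valP s; rewrite /= in_itv. Qed.

Lemma history_at_dist (sigma sigma' : E) (s : R) : - tau <= s <= 0 ->
  enorm (history_at sigma s - history_at sigma' s) <= `|sigma - sigma'|.
Proof.
move=> hs; rewrite !history_at_in.
exact: (le_history_norm (sigma - sigma') (delay_point hs)).
Qed.

Lemma segment_dist (x y : R -> 'rV[R]_d) (s t c : R) :
  {within `[- tau, +oo[, continuous x} -> {within `[- tau, +oo[, continuous y} ->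
  0 <= s -> 0 <= t -> 0 <= c ->
  (forall u, - tau <= u <= 0 -> enorm (x (s + u) - y (t + u)) <= c) ->
  `|segment tau x s - segment tau y t| <= c.
Proof.
move=> cx cy s0 t0 c0 h; apply: history_norm_le => // u.
rewrite [X in enorm X](_ : _ = segment tau x s u - segment tau y t u)//.
by rewrite !segmentE//; apply: h; exact: delay_bounds.
Qed.

End histories.

Lemma coordB (R : realType) d (v w : 'rV[R]_d) i : (v - w) 0 i = v 0 i - w 0 i.
Proof. by rewrite !mxE. Qed.

Section mean_field.
Context {R : realType} {d : nat} {tau : R}.
Local Notation E := (history d tau).
Local Notation leb := (@lebesgue_measure R).
Variables (K : 'rV[R]_d -> E -> 'rV[R]_d) (L : R).
Hypothesis L0 : 0 < L.
Hypothesis lipK : forall (x x' : 'rV[R]_d) (sigma sigma' : E),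
  enorm (K x sigma - K x' sigma') <= L * (enorm (x - x') + `|sigma - sigma'|).
Implicit Types (alpha beta : probability E R) (mu nu : R -> probability E R).

Lemma kernel_pairing_lipschitz (v x : 'rV[R]_d) :
  history_lipschitz (enorm v * L) (fun sigma => \sum_(i < d) v 0 i * K x sigma 0 i).
Proof.
move=> s s'; rewrite -sumrB.
under eq_bigr do rewrite -mulrBr.
have h (w : 'rV[R]_d) : \sum_(i < d) w 0 i * (K x s 0 i - K x s' 0 i) <=
    enorm w * L * `|s - s'|.
  under eq_bigr => i _ do rewrite -[_ - _](coordB (K x s) (K x s')).
  apply: le_trans (enorm_cauchy_schwarz _ _) _.
  rewrite -mulrA ler_wpM2l ?enorm_ge0//.
  by have := lipK x x s s'; rewrite subrr enorm0 add0r.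
rewrite ler_norml h andbT lerNl -sumrN.
have := h (- v); rewrite enormN.
by under eq_bigr do rewrite mxE mulNr.
Qed.

Lemma kernel_coord_lipschitz x i : history_lipschitz L (fun sigma => K x sigma 0 i).
Proof.
move=> s s'; have := coord_le_enorm (K x s - K x s') i.
rewrite !mxE => /le_trans; apply.
by have := lipK x x s s'; rewrite subrr enorm0 add0r.
Qed.

Lemma kernel_integrable alpha x : finite_first_moment alpha ->
  coord_integrable alpha setT (K x).
Proof.
by move=> a1 i; exact: history_lipschitz_integrable (kernel_coord_lipschitz x i).
Qed.

(** Pairing the difference of the two integrals with itself turns the kernel
    into a Lipschitz test function, so the dual distance controls the
    dependence on the law. *)
Lemma mean_field_lipschitz alpha beta x y :
  finite_first_moment alpha -> finite_first_moment beta ->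
  enorm (vec_integral alpha setT (K x) - vec_integral beta setT (K y)) <=
  L * (enorm (x - y) + w1 alpha beta).
Proof.
move=> a1 b1.
apply: le_trans (ler_enorm_distD (vec_integral alpha setT (K y)) _ _) _.
rewrite mulrDr; apply: lerD.
  rewrite -(Rintegral_probability_cst alpha (L * enorm (x - y))).
  apply: enorm_vec_integralB => //; [exact: kernel_integrable..| |].
    exact: finite_measure_integrable_cst.
  by move=> s _; have := lipK x y s s; rewrite subrr normr0 addr0.
set v := _ - _.
have [v0|v0] := eqVneq (enorm v) 0.
  by rewrite v0 mulr_ge0 ?w1_ge0// ltW.
have vp : 0 < enorm v by rewrite lt_neqAle eq_sym v0 enorm_ge0.
rewrite -(ler_pM2l vp) -expr2 enorm_sqr mulrA.
have [_ aE] := integrable_dot measurableT v (kernel_integrable y a1).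
have [_ bE] := integrable_dot measurableT v (kernel_integrable y b1).
have := w1_ge a1 b1 (mulr_gt0 vp L0) (@kernel_pairing_lipschitz v y).
rewrite aE bE -sumrB.
by under eq_bigr do rewrite -mulrBr -[_ - _](coordB _ _) -expr2.
Qed.

Lemma mean_field_continuous mu (x : R -> 'rV[R]_d) :
  P1_continuous_curve mu -> {within `[0, +oo[, continuous x} ->
  {within `[0, +oo[, continuous (fun s => mean_field K mu s (x s))}.
Proof.
move=> cmu cx; have [mu1 _] := cmu.
apply/subspace_continuousP => t; rewrite /= in_itv/= andbT => t0.
apply/cvg_enormP => e e0.
move/subspace_continuousP : cx => /(_ t).
rewrite /= in_itv/= andbT => /(_ t0) /cvg_enormP cx.
have eL : 0 < e / L / 2 by rewrite !divr_gt0.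
near=> s.
have s0 : 0 <= s.
  have : `[0, +oo[%classic s by near: s; exact: withinT.
  by rewrite /= in_itv/= andbT.
apply: le_lt_trans (mean_field_lipschitz _ _ (mu1 _ s0) (mu1 _ t0)) _.
rewrite mulrC -ltr_pdivlMr// (splitr (e / L)) ltrD//.
  by near: s; exact: cx.
near: s; have [_ /(_ t t0)/fine_cvgP[_ /cvgrPdist_lt/(_ _ eL)]] := cmu.
by apply: filterS => s; rewrite sub0r normrN; apply: le_lt_trans; exact: ler_norm.
Unshelve. all: by end_near. Qed.

Lemma within_coord_continuous (A : set R) (x : R -> 'rV[R]_d) i :
  {within A, continuous x} -> {within A, continuous (fun s => x s 0 i)}.
Proof.
move=> cx s.
exact: (@continuous_comp _ _ _ (x : subspace A -> _) (fun v => v 0 i) s (cx s)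
  (@coord_continuous _ _ _ _ _ _)).
Qed.

Lemma mean_field_integrable mu (x : R -> 'rV[R]_d) T :
  P1_continuous_curve mu -> {within `[0, +oo[, continuous x} ->
  coord_integrable leb `[0, T] (fun s => mean_field K mu s (x s)).
Proof.
move=> cmu cx i; apply: within_continuous_integrable.
apply: within_continuousSy.
by apply: within_coord_continuous; exact: mean_field_continuous.
Qed.

End mean_field.

(** * Stability and uniqueness *)

Section stability.
Context {R : realType} {d : nat} {tau : R}.
Local Notation E := (history d tau).
Local Notation leb := (@lebesgue_measure R).
Variables (K : 'rV[R]_d -> E -> 'rV[R]_d) (L : R).
Hypothesis tau0 : 0 < tau.
Hypothesis L0 : 0 < L.
Hypothesis lipK : forall (x x' : 'rV[R]_d) (sigma sigma' : E),
  enorm (K x sigma - K x' sigma') <= L * (enorm (x - x') + `|sigma - sigma'|).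
Implicit Types (mu nu : R -> probability E R).

Definition delay_solution mu (x0 : E) (x : R -> 'rV[R]_d) : Prop :=
  (forall t, 0 <= t -> x t = history_at x0 0 +
     vec_integral leb `[0, t] (fun s => mean_field K mu s (x s))) /\
  (forall t, - tau <= t <= 0 -> x t = history_at x0 t).

Lemma within_nonneg (x : R -> 'rV[R]_d) : {within `[- tau, +oo[, continuous x} ->
  {within `[0, +oo[, continuous x}.
Proof.
apply: continuous_subspaceW => s /=; rewrite !in_itv/= !andbT.
by apply: le_trans; rewrite oppr_le0 ltW.
Qed.

(** Gronwall's inequality for two single paths driven by two law curves: only
    the initial histories and the distance of the driving laws enter. *)
Lemma delay_solution_dist mu nu (x0 y0 : E) (x y : R -> 'rV[R]_d) T t :
  P1_continuous_curve mu -> P1_continuous_curve nu ->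
  {within `[- tau, +oo[, continuous x} -> {within `[- tau, +oo[, continuous y} ->
  delay_solution mu x0 x -> delay_solution nu y0 y -> 0 <= T -> - tau <= t <= T ->
  enorm (x t - y t) <= expR (L * T) *
    (`|x0 - y0| + L * \int[leb]_(s in `[0, T]) w1 (mu s) (nu s)).
Proof.
move=> cmu cnu /within_nonneg cx /within_nonneg cy [xE x0E] [yE y0E] T0.
move=> /andP[taut tT].
have [mu1 _] := cmu; have [nu1 _] := cnu.
pose D s := w1 (mu s) (nu s).
have cD : {within `[0, +oo[, continuous D} by exact: w1_continuous.
have D0 s : 0 <= s -> 0 <= D s.
  by move=> s0; rewrite w1_ge0//; [exact: mu1|exact: nu1].
set a := `|x0 - y0| + _.
have x0a : `|x0 - y0| <= a.
  rewrite lerDl mulr_ge0 ?(ltW L0)// Rintegral_ge0// => s /=.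
  by rewrite in_itv/= => /andP[/D0].
have a0 : 0 <= a by exact: le_trans x0a.
have eT s : s <= T -> expR (L * s) <= expR (L * T).
  by move=> sT; rewrite ler_expR ler_pM2l.
have [t0|t0] := leP t 0.
  rewrite x0E ?y0E ?taut ?t0//.
  apply: le_trans (history_at_dist _ _ _) _; first by rewrite taut.
  rewrite (le_trans x0a)// -[leLHS]mul1r ler_wpM2r// -expR0.
  by rewrite ler_expR mulr_ge0// ltW.
pose u s := enorm (x s - y s).
have cu : {within `[0, +oo[, continuous u}.
  move=> s; exact: (@continuous_comp _ _ _
    ((fun s => x s - y s) : subspace `[0, +oo[ -> 'rV[R]_d) (@enorm R d) s
    (continuousB (cx s) (cy s)) (@enorm_continuous _ _ _)).
apply: (@le_trans _ _ (a * expR (L * t))); last first.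
  by rewrite mulrC ler_wpM2r// eT.
apply: (@gronwall _ u a L T) => //; last by rewrite tT ltW.
- exact: ltW.
- exact: within_continuousSy.
move=> {t0 tT taut}t /andP[t0 tT].
rewrite /u xE// yE// opprD addrACA.
apply: le_trans (ler_enormD _ _) _.
have iu := within_continuous_integrable (within_continuousSy (T:=t) cu).
have iD := within_continuous_integrable (within_continuousSy (T:=t) cD).
have h : enorm (vec_integral leb `[0, t] (fun s => mean_field K mu s (x s)) -
   vec_integral leb `[0, t] (fun s => mean_field K nu s (y s))) <=
   \int[leb]_(s in `[0, t]) (L * (u s + D s)).
  apply: enorm_vec_integralB => //.
  - exact: (mean_field_integrable L0 lipK).
  - exact: (mean_field_integrable L0 lipK).
  - by apply: integrableZ_EFin => //; exact: integrableD_EFin.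
  - move=> s /=; rewrite in_itv/= => /andP[s0 st].
    by apply: (mean_field_lipschitz L0 lipK); [exact: mu1|exact: nu1].
rewrite RintegralZl// in h; last exact: integrableD_EFin.
rewrite RintegralD// mulrDr in h.
rewrite /a -addrA; apply: lerD.
  by apply: history_at_dist; rewrite lexx oppr_le0 ltW.
apply: le_trans h _; rewrite addrC; apply: lerD => //; rewrite ler_pM2l//.
apply: ge0_Rintegral_itvS; first by rewrite t0.
  exact: within_continuousSy.
by move=> s /andP[/D0].
Qed.

Context d1 d2 (O1 : measurableType d1) (O2 : measurableType d2).
Variables (P1 : probability O1 R) (P2 : probability O2 R).
Variables (X0 : O1 -> E) (Y0 : O2 -> E).
Variables (X : O1 -> R -> 'rV[R]_d) (Y : O2 -> R -> 'rV[R]_d).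
Variables (mu nu : R -> probability E R) (mu_in nu_in : probability E R).
Hypotheses (mu_in1 : finite_first_moment mu_in) (nu_in1 : finite_first_moment nu_in).
Hypotheses (X0l : has_law P1 X0 mu_in) (Y0l : has_law P2 Y0 nu_in).
Hypothesis Xsol : pathwise_solution K P1 X0 X mu.
Hypothesis Ysol : pathwise_solution K P2 Y0 Y nu.

Let cmu := sol_curve Xsol.
Let cnu := sol_curve Ysol.
Let mu1 t (t0 : 0 <= t) : finite_first_moment (mu t) := cmu.1 t t0.
Let nu1 t (t0 : 0 <= t) : finite_first_moment (nu t) := cnu.1 t t0.

(** The pathwise estimate holds between every good sample path of X and every
    good sample path of Y, which is what the comparison of image laws
    requires. *)
Lemma w1_integral_inequality T : 0 <= T ->
  w1 (mu T) (nu T) <= expR (L * T) * w1 mu_in nu_in +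
    expR (L * T) * (L * \int[leb]_(s in `[0, T]) w1 (mu s) (nu s)).
Proof.
move=> T0.
apply: (w1_comparison X0l (sol_law Xsol T0) Y0l (sol_law Ysol T0) mu_in1 (mu1 T0)
  nu_in1 (nu1 T0) (sol_equation Xsol) (sol_equation Ysol) (expR_gt0 _)).
move=> w w' Gw Gw'; rewrite -mulrDr.
apply: segment_dist => //.
- exact: (sol_continuous Xsol).
- exact: (sol_continuous Ysol).
- rewrite mulr_ge0 ?expR_ge0// addr_ge0// mulr_ge0 ?(ltW L0)// Rintegral_ge0// => s /=.
  by rewrite in_itv/= => /andP[s0 _]; rewrite w1_ge0//; [exact: mu1|exact: nu1].
move=> u /andP[tu u0].
apply: (delay_solution_dist cmu cnu) => //.
- exact: (sol_continuous Xsol).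
- exact: (sol_continuous Ysol).
- by rewrite gerDl u0 andbT (le_trans tu)// lerDr.
Qed.

(** The distance of the laws appears on both sides of the integral inequality,
    so a second use of Gronwall's inequality closes the estimate. *)
Lemma w1_stability T : 0 <= T -> w1 (mu T) (nu T) <=
  expR (L * T) * expR (expR (L * T) * L * T) * w1 mu_in nu_in.
Proof.
move=> T0; rewrite mulrAC.
have eT s : s <= T -> expR (L * s) <= expR (L * T).
  by move=> sT; rewrite ler_expR ler_pM2l.
apply: (@gronwall _ (fun s => w1 (mu s) (nu s)) _ _ T); last by rewrite lexx T0.
- by rewrite mulr_ge0 ?expR_ge0// ltW.
- by apply: within_continuousSy; exact: w1_continuous.
move=> t /andP[t0 tT]; apply: le_trans (w1_integral_inequality t0) _.
rewrite -mulrA lerD// ler_wpM2r ?eT ?w1_ge0//.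
rewrite mulr_ge0 ?(ltW L0)// Rintegral_ge0// => s /=.
by rewrite in_itv/= => /andP[s0 _]; rewrite w1_ge0//; [exact: mu1|exact: nu1].
Qed.

End stability.

Section uniqueness.
Context {R : realType} {d : nat} {tau : R}.
Local Notation E := (history d tau).
Variables (K : 'rV[R]_d -> E -> 'rV[R]_d) (L : R).
Hypothesis tau0 : 0 < tau.
Hypothesis L0 : 0 < L.
Hypothesis lipK : forall (x x' : 'rV[R]_d) (sigma sigma' : E),
  enorm (K x sigma - K x' sigma') <= L * (enorm (x - x') + `|sigma - sigma'|).
Context dO (Omega : measurableType dO) (P : probability Omega R).
Variables (X0 : Omega -> E) (mu_in : probability E R).
Hypotheses (mu_in1 : finite_first_moment mu_in) (X0l : has_law P X0 mu_in).

(** Two solutions from the same initial variable have the same laws by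
    stability, hence almost every sample path solves the same equation, whose
    solution is unique. *)
Lemma pathwise_uniqueness (X Y : Omega -> R -> 'rV[R]_d)
    (mu nu : R -> probability E R) :
  pathwise_solution K P X0 X mu -> pathwise_solution K P X0 Y nu ->
  {ae P, forall w, forall t, - tau <= t -> X w t = Y w t}.
Proof.
move=> Xsol Ysol.
have [mu1 _] := sol_curve Xsol; have [nu1 _] := sol_curve Ysol.
have W0 s : 0 <= s -> w1 (mu s) (nu s) = 0.
  move=> s0; apply/eqP; rewrite eq_le w1_ge0 ?andbT; [|by auto..].
  apply: le_trans (w1_stability tau0 L0 lipK mu_in1 mu_in1 X0l X0l Xsol Ysol s0) _.
  by rewrite w1_refl// mulr0.
apply: filterS2 (sol_equation Xsol) (sol_equation Ysol) => w Xw Yw t taut.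
apply/eqP; rewrite -subr_eq0; apply/eqP/enorm0_eq0/eqP.
rewrite eq_le enorm_ge0 andbT.
have T0 : 0 <= Num.max t 0 by rewrite le_max lexx orbT.
have tT : - tau <= t <= Num.max t 0 by rewrite taut le_max lexx.
have cX : {within `[- tau, +oo[, continuous (X w)} by exact: (sol_continuous Xsol).
have cY : {within `[- tau, +oo[, continuous (Y w)} by exact: (sol_continuous Ysol).
apply: le_trans (delay_solution_dist tau0 L0 lipK (sol_curve Xsol) (sol_curve Ysol)
  cX cY Xw Yw T0 tT) _.
rewrite subrr normr0 add0r (@eq_Rintegral _ _ _ _ _ (fun=> 0)).
  by rewrite Rintegral_cst// mul0r !mulr0.
by move=> s; rewrite inE/= in_itv/= => /andP[/W0].
Qed.

End uniqueness.

(** * Geometric convergence and continuous paths *)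

Section geometric_sequences.
Context {R : realType}.

Lemma geometric_lt (c e : R) : 0 < e -> exists n, c * 2^-1 ^+ n < e.
Proof.
move=> e0; have : @geometric R c 2^-1 @ \oo --> 0.
  by apply: cvg_geometric; rewrite ger0_norm ?invr_ge0// invf_lt1// ltr1n.
move=> /cvgrPdist_lt/(_ e e0)[n _ /(_ n (leqnn n))]; rewrite /= sub0r normrN => h.
by exists n; apply: le_lt_trans h; exact: ler_norm.
Qed.

Lemma ler_geometric (a b c : R) : (forall n, a <= b + c * 2^-1 ^+ n) -> a <= b.
Proof.
move=> h; apply/ler_addgt0Pr => e /(geometric_lt c)[n cn].
by rewrite (le_trans (h n))// lerD2l ltW.
Qed.

(** The sequences u n - 2 c / 2^n and u n + 2 c / 2^n are monotone and enclose
    the limit, so the supremum of the former gives the limit together with the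
    rate. *)
Lemma geometric_cauchy_real (u : nat -> R) (c : R) :
  (forall n, `|u n.+1 - u n| <= c * 2^-1 ^+ n) ->
  exists l, forall n, `|l - u n| <= 2 * c * 2^-1 ^+ n.
Proof.
move=> uc.
have c0 : 0 <= c by have := le_trans (normr_ge0 _) (uc 0%N); rewrite expr0 mulr1.
pose e n : R := 2 * c * 2^-1 ^+ n.
have e0 n : 0 <= e n by rewrite !mulr_ge0// exprn_ge0// invr_ge0.
have eS n : e n.+1 = e n - c * 2^-1 ^+ n by rewrite /e exprS; field.
have lo n m : u n - e n <= u (n + m)%N - e (n + m)%N.
  elim: m => [|m IH]; first by rewrite addn0.
  apply: le_trans IH _; rewrite addnS eS.
  by have := uc (n + m)%N; rewrite ler_norml => /andP[? _]; lra.
have hi n m : u (n + m)%N + e (n + m)%N <= u n + e n.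
  elim: m => [|m IH]; first by rewrite addn0.
  apply: le_trans _ IH; rewrite addnS eS.
  by have := uc (n + m)%N; rewrite ler_norml => /andP[_ ?]; lra.
pose S := range (fun n => u n - e n).
have Sub n : ubound S (u n + e n).
  move=> _ [m _ <-]; have h1 := lo m n; have h2 := hi n m.
  rewrite addnC in h1; have h3 := e0 (n + m)%N; lra.
have S0 : S !=set0 by exists (u 0%N - e 0%N); exists 0%N.
exists (sup S) => n; rewrite -/(e n) ler_norml; apply/andP; split.
  have : u n - e n <= sup S.
    by apply: sup_ubound; [exists (u 0%N + e 0%N); exact: Sub|exists n].
  lra.
have : sup S <= u n + e n by apply: ge_sup => //; exact: Sub.
lra.
Qed.

Lemma geometric_cauchy_vector d (u : nat -> 'rV[R]_d) (c : R) :
  (forall n, enorm (u n.+1 - u n) <= c * 2^-1 ^+ n) ->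
  exists l, forall n, enorm (l - u n) <= d%:R * (2 * c) * 2^-1 ^+ n.
Proof.
move=> uc.
have /choice[l lE] i : exists l, forall n, `|l - u n 0 i| <= 2 * c * 2^-1 ^+ n.
  apply: geometric_cauchy_real => n; apply: le_trans (uc n).
  by have := coord_le_enorm (u n.+1 - u n) i; rewrite !mxE.
exists (\row_i l i) => n; apply: le_trans (enorm_le_sum _) _.
rewrite -mulrA -[d in d%:R]card_ord -sum1_card natr_sum mulr_suml.
by apply: ler_sum => i _; rewrite !mxE mul1r.
Qed.

End geometric_sequences.

Section paths.
Context {R : realType} {d : nat}.

Lemma continuous_rV (T : topologicalType) (f : T -> 'rV[R]_d) :
  (forall i, continuous (fun t => f t 0 i)) -> continuous f.
Proof.
move=> cf t; apply/cvg_enormP => e e0.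
have ed : 0 < e / d.+1%:R by rewrite divr_gt0.
have : \forall s \near t, forall i, `|f t 0 i - f s 0 i| < e / d.+1%:R.
  apply: filter_forall => i.
  by have /cvgrPdist_lt/(_ _ ed) := cf i t.
apply: filterS => s h; apply: le_lt_trans (enorm_le_sum _) _.
apply: (@le_lt_trans _ _ (\sum_(i < d) e / d.+1%:R)).
  by apply: ler_sum => i _; rewrite !mxE distrC ltW.
rewrite sumr_const card_ord -(mulr_natl (e / _)) mulrA ltr_pdivrMr// mulrC.
by rewrite ltr_pM2l// ltr_nat.
Qed.

Variable tau : R.
Hypothesis tau0 : 0 < tau.
Local Notation E := (history d tau).

Lemma clamp_bounds (t : R) : - tau <= Num.max (- tau) (Num.min t 0) <= 0.
Proof. by rewrite le_max lexx/= ge_max oppr_le0 ltW//= ge_min lexx orbT. Qed.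

Definition clamp (t : R) : delay tau := delay_point (clamp_bounds t).

Lemma clamp_in (t : R) : - tau <= t <= 0 -> val (clamp t) = t.
Proof. by case/andP=> h1 h2 /=; rewrite min_l// max_r. Qed.

Lemma clamp_continuous : continuous clamp.
Proof.
have c1 : continuous (fun t : R => Num.min t 0).
  move=> t; exact: (@continuous_min _ R id (cst 0) t (@cvg_id _ _)
    (@cvg_cst _ _ _ _ _)).
have c2 : continuous (fun t : R => Num.max (- tau) (Num.min t 0)).
  move=> t; exact: (@continuous_max _ R (cst (- tau)) (fun t => Num.min t 0) t
    (@cvg_cst _ _ _ _ _) (c1 t)).
exact: (@continuous_comp_initial _ _ _ (val : delay tau -> R) clamp c2).
Qed.

(** The path that follows the history and is constant outside of [- tau, 0];
    the constant extension to the left keeps all paths continuous on the whole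
    line. *)
Definition frozen (sigma : E) (t : R) : 'rV[R]_d := sigma (clamp t).

Lemma frozen_continuous sigma : continuous (frozen sigma).
Proof.
by move=> t; apply: continuous_comp; [exact: clamp_continuous|exact: cts_fun].
Qed.

Lemma frozenE sigma t : - tau <= t <= 0 -> frozen sigma t = history_at sigma t.
Proof. by move=> ht; rewrite -[in RHS](clamp_in ht) history_atE. Qed.

Lemma frozen_dist sigma sigma' t :
  enorm (frozen sigma t - frozen sigma' t) <= `|sigma - sigma'|.
Proof. exact: (le_history_norm (sigma - sigma') (clamp t)). Qed.

Lemma max0_dist (s t : R) : `|Num.max s 0 - Num.max t 0| <= `|s - t|.
Proof.
have [hs|hs] := leP s 0; have [ht|ht] := leP t 0.
- by rewrite subrr normr0.
- by rewrite sub0r normrN gtr0_norm// ler_normr; apply/orP; right; lra.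
- by rewrite subr0 gtr0_norm// ler_normr; apply/orP; left; lra.
- by [].
Qed.

Lemma max0_ge0 (s : R) : 0 <= Num.max s 0.
Proof. by rewrite le_max lexx orbT. Qed.

(** Uniform continuity of the path on compact intervals, obtained by covering
    [- tau, 0]. *)
Lemma segment_continuous (x : R -> 'rV[R]_d) (t e : R) : continuous x -> 0 < e ->
  \forall s \near t,
    `|segment tau x (Num.max s 0) - segment tau x (Num.max t 0)| <= e.
Proof.
move=> cx e0.
have cxw : {within `[- tau, +oo[, continuous x} by exact: continuous_subspaceT.
pose P s u := enorm (x (Num.max s 0 + u) - x (Num.max t 0 + u)) <= e.
have : \forall s \near t, `[- tau, 0]%classic `<=` P s.
  have /compact_near_coveringP nc := @segment_compact R (- tau) 0.
  apply: (nc _ (nbhs t) P) => u _.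
  have e2 : 0 < e / 2 by rewrite divr_gt0.
  have /cvg_enormP/(_ _ e2) := cx (Num.max t 0 + u).
  move=> /nbhs_ballP[r /= r0 hr].
  have r2 : 0 < r / 2 by rewrite divr_gt0.
  exists (ball u (r / 2), ball t (r / 2)); first by split; exact: nbhsx_ballx.
  move=> [u' s] [/=]; rewrite /ball/= => hu hs; rewrite /P.
  apply: le_trans (ler_enorm_distD (x (Num.max t 0 + u)) _ _) _.
  rewrite (splitr e); apply: lerD.
    apply/ltW/hr; rewrite /ball/= opprD addrACA.
    apply: le_lt_trans (ler_normD _ _) _; rewrite (splitr r) ltrD//.
    exact: le_lt_trans (max0_dist _ _) hs.
  rewrite enormBC; apply/ltW/hr; rewrite /ball/= opprD addrACA subrr add0r.
  by apply: lt_trans hu _; rewrite [ltRHS]splitr ltrDl.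
apply: filterS => s hs; apply: segment_dist => //; try exact: max0_ge0.
  exact: ltW.
Qed.

End paths.

(** * Flows of paths indexed by the initial history *)

Section flows.
Context {R : realType} {d : nat} {tau : R}.
Local Notation E := (history d tau).
Variables (K : 'rV[R]_d -> E -> 'rV[R]_d) (L : R).
Hypothesis tau0 : 0 < tau.
Hypothesis L0 : 0 < L.
Hypothesis lipK : forall (x x' : 'rV[R]_d) (sigma sigma' : E),
  enorm (K x sigma - K x' sigma') <= L * (enorm (x - x') + `|sigma - sigma'|).
Variable mu0 : probability E R.
Hypothesis mu01 : finite_first_moment mu0.
Implicit Types (Z : E -> R -> 'rV[R]_d) (sigma : E).

Local Notation pos t := (Num.max t (0 : R)).

(** A candidate for the solution started from each deterministic history. The
    Lipschitz bound in the history makes segments measurable and integrable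
    under the initial law, and it has the growth that an L-Lipschitz vector
    field produces, so that it is preserved by the Picard operator. *)
Record flow Z : Prop := Flow {
  flow_continuous : forall sigma, continuous (Z sigma) ;
  flow_lipschitz : forall sigma sigma' t,
    enorm (Z sigma t - Z sigma' t) <= expR (L * pos t) * `|sigma - sigma'| ;
  flow_init : forall sigma t, t <= 0 -> Z sigma t = frozen tau0 sigma t }.

(** Times are clamped at 0, where segments stop being meaningful, so that
    everything depends continuously on t on the whole line. *)
Definition flow_segment Z (t : R) (sigma : E) : E := segment tau (Z sigma) (pos t).

Lemma pos_le_expR t u : u <= 0 -> expR (L * pos (pos t + u)) <= expR (L * pos t).
Proof.
move=> u0; rewrite ler_expR ler_pM2l// ge_max max0_ge0 andbT.
by rewrite gerDl.
Qed.

Section one_flow.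
Variable Z : E -> R -> 'rV[R]_d.
Hypothesis flowZ : flow Z.

Lemma flow_within sigma : {within `[- tau, +oo[, continuous (Z sigma)}.
Proof. by apply: continuous_subspaceT; exact: flow_continuous. Qed.

Lemma flow_segment_lipschitz t sigma sigma' :
  `|flow_segment Z t sigma - flow_segment Z t sigma'| <=
  expR (L * pos t) * `|sigma - sigma'|.
Proof.
apply: segment_dist; rewrite ?max0_ge0 ?mulr_ge0 ?expR_ge0//; try exact: flow_within.
move=> u /andP[_ u0]; apply: le_trans (flow_lipschitz flowZ _ _ _) _.
by rewrite ler_wpM2r// pos_le_expR.
Qed.

Lemma flow_segment_measurable t : measurable_fun setT (flow_segment Z t).
Proof.
apply: continuous_history_measurableE => s.
apply: (iffRL (@cvgrPdist_lt _ _ _ _ (nbhs_filter s) _ _)) => e e0.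
have /(@cvgrPdist_lt _ E _ _ (nbhs_filter s) id s) hs :
  s' @[s' --> s] --> s by exact: cvg_id.
have /hs : 0 < e / expR (L * pos t) by rewrite divr_gt0// expR_gt0.
apply: filterS => s'; rewrite ltr_pdivlMr ?expR_gt0// mulrC; apply: le_lt_trans.
exact: flow_segment_lipschitz.
Qed.

Lemma history_lipschitz_segment l phi t : 0 <= l -> history_lipschitz l phi ->
  history_lipschitz (l * expR (L * pos t)) (phi \o flow_segment Z t).
Proof.
move=> l0 lp s s'; apply: le_trans (lp _ _) _.
by rewrite -mulrA ler_wpM2l// flow_segment_lipschitz.
Qed.

Lemma kernel_segment_integrable t x :
  coord_integrable mu0 setT (fun sigma => K x (flow_segment Z t sigma)).
Proof.
move=> i; exact: (history_lipschitz_integrable mu01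
  (history_lipschitz_segment t (ltW L0) (kernel_coord_lipschitz lipK x i))).
Qed.

End one_flow.

Definition segment_gap Z s Z' t (sigma : E) : R :=
  `|flow_segment Z s sigma - flow_segment Z' t sigma|.

Lemma segment_gap_lipschitz Z Z' s t : flow Z -> flow Z' ->
  history_lipschitz (expR (L * pos s) + expR (L * pos t)) (segment_gap Z s Z' t).
Proof.
move=> fZ fZ' a b; rewrite /segment_gap.
apply: le_trans (ler_dist_dist _ _) _; rewrite opprD addrACA -opprD.
apply: le_trans (ler_normD _ _) _; rewrite normrN mulrDl.
by apply: lerD; exact: flow_segment_lipschitz.
Qed.

Lemma segment_gap_integrable Z Z' s t : flow Z -> flow Z' ->
  mu0.-integrable setT (EFin \o segment_gap Z s Z' t).
Proof.
move=> fZ fZ'; exact: (history_lipschitz_integrable mu01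
  (segment_gap_lipschitz s t fZ fZ')).
Qed.

(** The mean field of the law at time s of the segments of Z, written as an
    integral over initial histories; see [mean_field_flow_law]. *)
Definition flow_field Z (s : R) (x : 'rV[R]_d) : 'rV[R]_d :=
  vec_integral mu0 setT (fun sigma => K x (flow_segment Z s sigma)).

Lemma flow_field_dist Z Z' s t x y : flow Z -> flow Z' ->
  enorm (flow_field Z s x - flow_field Z' t y) <=
  L * (enorm (x - y) + \int[mu0]_sigma segment_gap Z s Z' t sigma).
Proof.
move=> fZ fZ'.
have ig := segment_gap_integrable s t fZ fZ'.
have ic := finite_measure_integrable_cst mu0 (enorm (x - y)) measurableT.
have icg : mu0.-integrable setT
    (EFin \o (fun sigma => enorm (x - y) + segment_gap Z s Z' t sigma)).
  exact: integrableD_EFin.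
rewrite -[X in L * (X + _)](Rintegral_probability_cst mu0) -RintegralD//.
rewrite -RintegralZl//.
apply: enorm_vec_integralB => //; try exact: kernel_segment_integrable.
  exact: integrableZ_EFin.
Qed.

(** Each segment moves continuously, but not uniformly over the initial
    histories, whence dominated convergence. The dominating function compares
    each path with the path started from the zero history. *)
Lemma segment_gap_continuous Z t e : flow Z -> 0 < e ->
  \forall s \near t, \int[mu0]_sigma segment_gap Z s Z t sigma < e.
Proof.
move=> fZ e0.
(* times near t are below t + 1, and m maximizes the path from the zero history
   up to such times *)
pose T := pos t + 1.
have tT : pos t <= T by rewrite /T lerDl.
have T0 : - tau <= T.
  by apply: (le_trans _ (le_trans (max0_ge0 t) tT)); rewrite oppr_le0 ltW.
have [m _ hm] : exists2 c, c \in `[- tau, T]%R & forall s, s \in `[- tau, T]%R ->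
    enorm (Z 0 s) <= enorm (Z 0 c).
  apply: (@EVT_max _ (fun s => enorm (Z 0 s))) => //; apply: continuous_subspaceT => s.
  apply: (@continuous_comp _ _ _ (Z 0) (@enorm R d)).
    exact: flow_continuous.
  exact: enorm_continuous.
pose M := enorm (Z 0 m); pose l := expR (L * T).
have posT s : s < t + 1 -> pos s <= T.
  rewrite /T => st; rewrite ge_max (le_trans (ltW st)) ?lerD2r ?le_max ?lexx//=.
  by rewrite addr_ge0// le_max lexx orbT.
have segM s sigma : pos s <= T -> `|flow_segment Z s sigma| <= M + l * `|sigma|.
  move=> sT; rewrite -[X in `|X|](subrK (flow_segment Z s 0)) addrC.
  apply: le_trans (ler_normD _ _) _; apply: lerD.
    apply: history_norm_le => [|u]; first exact: enorm_ge0.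
    have /andP[hu hu0] := delay_bounds u.
    rewrite /flow_segment segmentE; [|exact: flow_within|exact: max0_ge0].
    apply: hm; rewrite in_itv/= (le_trans hu) ?lerDr ?max0_ge0//=.
    by rewrite (le_trans _ sT)// gerDl.
  apply: le_trans (flow_segment_lipschitz fZ _ _ _) _.
  by rewrite subr0 ler_wpM2r// ler_expR ler_pM2l.
pose g (sigma : E) := 2 * (M + l * `|sigma|).
have ig : mu0.-integrable setT (EFin \o g).
  apply: integrableZ_EFin => //; apply: integrableD_EFin => //.
    exact: finite_measure_integrable_cst.
  by apply: integrableZ_EFin => //; exact: integrable_history_norm.
have c := @continuity_under_integral R _ _ mu0 (fun s => segment_gap Z s Z t) setT
  measurableT (t - 1) (t + 1).
have /c{c} c : forall s, `]t - 1, t + 1[%classic s ->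
   mu0.-integrable setT (EFin \o segment_gap Z s Z t).
  by move=> s _; exact: segment_gap_integrable.
have /c{c}/(_ _ ig) c : {ae mu0, forall sigma, setT sigma ->
    {in `]t - 1, t + 1[%classic, continuous (fun s => segment_gap Z s Z t sigma)}}.
  apply: aeW => sigma _ s _.
  apply/cvgrPdist_le => eps eps0.
  have cZ : continuous (Z sigma) by exact: (flow_continuous fZ).
  have := segment_continuous tau s cZ eps0.
  apply: filterS => s' hs'.
  apply: le_trans (ler_dist_dist _ _) _.
  by rewrite opprB addrA subrK distrC.
have /c{c} c : forall s, `]t - 1, t + 1[%classic s ->
    {ae mu0, forall sigma, setT sigma -> `|segment_gap Z s Z t sigma| <= g sigma}.
  move=> s /=; rewrite in_itv/= => /andP[_ st]; apply: aeW => sigma _.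
  rewrite /segment_gap normr_id; apply: le_trans (ler_normB _ _) _.
  rewrite /g mulr2n mulrDl mul1r; apply: lerD; apply: segM => //.
  exact: posT.
have /c : t \in `]t - 1, t + 1[%classic.
  by rewrite inE/= in_itv/= ltrBlDr ltrDl ltr01.
move=> /cvgrPdist_lt/(_ e e0); apply: filterS => s.
rewrite [X in `|X - _|](_ : _ = 0) ?sub0r ?normrN.
  exact/le_lt_trans/ler_norm.
rewrite (@eq_Rintegral _ _ _ _ _ (fun=> 0)) ?Rintegral_probability_cst//.
by move=> sigma _; rewrite /segment_gap subrr normr0.
Qed.

Lemma flow_field_continuous Z sigma : flow Z ->
  continuous (fun s => flow_field Z s (Z sigma s)).
Proof.
move=> fZ t; apply/cvg_enormP => e e0.
have eL : 0 < e / L / 2 by rewrite !divr_gt0.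
have cZ : continuous (Z sigma) by exact: (flow_continuous fZ).
have /cvg_enormP/(_ _ eL) h1 := cZ t.
apply: filterS2 h1 (segment_gap_continuous t fZ eL) => s h1 h2.
apply: le_lt_trans (flow_field_dist _ _ _ _ fZ fZ) _.
by rewrite mulrC -ltr_pdivlMr// [ltRHS]splitr ltrD.
Qed.

End flows.

(** * The fixed point *)

Section picard.
Context {R : realType} {d : nat} {tau : R}.
Local Notation E := (history d tau).
Local Notation leb := (@lebesgue_measure R).
Variables (K : 'rV[R]_d -> E -> 'rV[R]_d) (L : R).
Hypothesis tau0 : 0 < tau.
Hypothesis L0 : 0 < L.
Hypothesis lipK : forall (x x' : 'rV[R]_d) (sigma sigma' : E),
  enorm (K x sigma - K x' sigma') <= L * (enorm (x - x') + `|sigma - sigma'|).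
Variable mu0 : probability E R.
Hypothesis mu01 : finite_first_moment mu0.
Implicit Types (Z : E -> R -> 'rV[R]_d) (sigma : E).

Local Notation flow := (@flow R d tau L tau0).
Local Notation field := (flow_field K mu0).

Definition picard Z : E -> R -> 'rV[R]_d := fun sigma t =>
  frozen tau0 sigma t +
  vec_integral leb `[0, t] (fun s => field Z s (Z sigma s)).

Lemma frozen_ge0 sigma t : 0 <= t -> frozen tau0 sigma t = history_at sigma 0.
Proof.
move=> t0; rewrite -(frozenE tau0 sigma (t := 0)) ?lexx ?oppr_le0 ?ltW//.
rewrite /frozen; congr (sigma _); apply: val_inj => /=.
by rewrite min_r// minxx.
Qed.

Lemma picard_init Z sigma t : t <= 0 -> picard Z sigma t = frozen tau0 sigma t.
Proof.
move=> t0; rewrite /picard (_ : vec_integral _ _ _ = 0) ?addr0//.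
apply/rowP => i; rewrite !mxE; move: t0; rewrite le_eqVlt => /predU1P[->|t0].
  by rewrite set_itv1 Rintegral_set1.
by rewrite set_itv_ge ?Rintegral_set0// bnd_simp -ltNge.
Qed.

Lemma flow_field_integrable Z sigma T : flow Z ->
  coord_integrable leb `[0, T] (fun s => field Z s (Z sigma s)).
Proof.
move=> fZ i; apply/within_continuous_integrable/continuous_subspaceT => s.
apply: (@continuous_comp _ _ _ (fun s => field Z s (Z sigma s))
  (fun v : 'rV[R]_d => v 0 i)).
  exact: (flow_field_continuous L0 lipK mu01).
exact: coord_continuous.
Qed.

Lemma expR_integrable b T :
  leb.-integrable `[0, T] (EFin \o (fun s => b * expR (b * s))).
Proof.
apply: integrableZ_EFin => //.
apply/within_continuous_integrable/continuous_subspaceT => x.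
apply: (@continuous_comp _ _ _ (fun s => b * s) expR).
  by apply: cvgMr => //; exact: cvg_id.
exact: continuous_expR.
Qed.

(** Since b exp(b s) integrates to exp(b t) - 1, integrating in time a bound that
    grows exponentially at rate b gains the factor b. *)
Lemma picard_dist Z Z' sigma sigma' t a b : flow Z -> flow Z' -> 0 <= t ->
  (forall s, 0 <= s -> enorm (field Z s (Z sigma s) - field Z' s (Z' sigma' s)) <=
     a * (b * expR (b * s))) ->
  enorm (picard Z sigma t - picard Z' sigma' t) <=
    enorm (history_at sigma 0 - history_at sigma' 0) + a * (expR (b * t) - 1).
Proof.
move=> fZ fZ' t0 h; rewrite /picard !frozen_ge0// opprD addrACA.
apply: le_trans (ler_enormD _ _) _; rewrite lerD2l -(Rintegral_expR b t0).
have ie := expR_integrable b t.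
rewrite -RintegralZl//.
apply: enorm_vec_integralB => //; [exact: flow_field_integrable..| |].
  exact: integrableZ_EFin.
by move=> s /=; rewrite in_itv/= => /andP[s0 _]; exact: h.
Qed.

Lemma flow_frozen : flow (frozen tau0).
Proof.
split=> // [sigma|sigma sigma' t]; first exact: frozen_continuous.
apply: le_trans (frozen_dist _ _ _ _) _.
by rewrite -[leLHS]mul1r ler_wpM2r// -expR0 ler_expR mulr_ge0 ?max0_ge0 ?ltW.
Qed.

(** The Lipschitz constant exp(L t) reproduces itself, since L exp(L s)
    integrates to exp(L t) - 1. *)
Lemma flow_picard Z : flow Z -> flow (picard Z).
Proof.
move=> fZ; split=> [sigma|sigma sigma' t|sigma t]; last exact: picard_init.
- have cI : continuous (fun t : R =>
      vec_integral leb `[0, t] (fun s => field Z s (Z sigma s))).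
    apply: continuous_rV => i; under eq_fun do rewrite mxE.
    apply: continuous_primitive => s.
    apply: (@continuous_comp _ _ _ (fun s => field Z s (Z sigma s))
  (fun v : 'rV[R]_d => v 0 i)).
      exact: (flow_field_continuous L0 lipK mu01).
    exact: coord_continuous.
  by move=> t; apply: continuousD; [exact: frozen_continuous|exact: cI].
- have /orP[t0|t0] := le_total t 0.
    rewrite !picard_init//; exact: (flow_lipschitz flow_frozen).
  have h s : 0 <= s -> enorm (field Z s (Z sigma s) - field Z s (Z sigma' s)) <=
      `|sigma - sigma'| * (L * expR (L * s)).
    move=> s0; apply: le_trans (flow_field_dist L0 lipK mu01 _ _ _ _ fZ fZ) _.
    rewrite (@eq_Rintegral _ _ _ _ _ (fun=> 0)) ?Rintegral_probability_cst//.
      rewrite addr0 [leRHS]mulrCA ler_pM2l// mulrC.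
      by have := flow_lipschitz fZ sigma sigma' s; rewrite max_l.
    by move=> s' _; rewrite /segment_gap subrr normr0.
  apply: le_trans (picard_dist fZ fZ t0 h) _.
  rewrite max_l//; apply: (@le_trans _ _ (`|sigma - sigma'| +
      `|sigma - sigma'| * (expR (L * t) - 1))).
    by rewrite lerD2r; apply: history_at_dist; rewrite lexx oppr_le0 ltW.
  by rewrite mulrBr mulr1 addrCA subrr addr0 mulrC.
Qed.

Let mass : R := 1 + \int[mu0]_sigma `|sigma|.
Let rate : R := 1 + 2 * (L * (1 + mass)).
Let weight sigma (t : R) : R := (1 + `|sigma|) * expR (rate * Num.max t 0).

(** The weighted uniform distance for which the Picard operator contracts. The
    factor 1 + |sigma| absorbs the linear growth of the kernel over unbounded
    histories, and the exponential makes the contraction global in time. *)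
Definition close (e : R) Z Z' :=
  forall sigma t, enorm (Z sigma t - Z' sigma t) <= e * weight sigma t.

Let mass_ge1 : 1 <= mass.
Proof. by rewrite lerDl Rintegral_ge0. Qed.

Let rate_ge1 : 1 <= rate.
Proof.
rewrite lerDl mulr_ge0// mulr_ge0 ?(ltW L0)// addr_ge0//.
exact: le_trans mass_ge1.
Qed.

Let rate_gt0 : 0 < rate.
Proof. exact: lt_le_trans rate_ge1. Qed.

Let weight_ge0 sigma t : 0 <= weight sigma t.
Proof. by rewrite mulr_ge0 ?expR_ge0// addr_ge0. Qed.

Let Rintegral_weight c : \int[mu0]_sigma (c * (1 + `|sigma|)) = c * mass.
Proof.
have ic := finite_measure_integrable_cst mu0 (1 : R) measurableT.
have im := integrable_history_norm mu01.
rewrite RintegralZl//; last exact: integrableD_EFin.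
by rewrite RintegralD// Rintegral_probability_cst.
Qed.

Let weight_integrable c :
  mu0.-integrable setT (EFin \o (fun sigma : E => c * (1 + `|sigma|))).
Proof.
apply: integrableZ_EFin => //; apply: integrableD_EFin => //.
  exact: finite_measure_integrable_cst.
exact: integrable_history_norm.
Qed.

Lemma gap_close e Z Z' s : flow Z -> flow Z' -> 0 <= e -> close e Z Z' -> 0 <= s ->
  \int[mu0]_sigma segment_gap Z s Z' s sigma <= e * expR (rate * s) * mass.
Proof.
move=> fZ fZ' e0 c s0; rewrite -Rintegral_weight.
apply: le_Rintegral => //; first exact: (segment_gap_integrable L0 mu01 _ _ fZ fZ').
move=> sigma _; rewrite /segment_gap /flow_segment.
apply: segment_dist; try exact: max0_ge0.
- exact: (flow_within fZ).
- exact: (flow_within fZ').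
- by rewrite !mulr_ge0 ?expR_ge0// addr_ge0.
move=> u /andP[_ u0]; apply: le_trans (c _ _) _.
rewrite /weight -mulrA ler_wpM2l// mulrC ler_wpM2r ?addr_ge0//.
rewrite (max_l s0) ler_expR ler_pM2l// ge_max s0 andbT.
by rewrite gerDl.
Qed.

(** If two flows are within e of each other in the weighted distance, then their
    fields differ by at most e L (1 + mass) times the weight, and the rate of the
    weight exceeds twice L (1 + mass). *)
Lemma picard_contraction e Z Z' : flow Z -> flow Z' -> 0 <= e -> close e Z Z' ->
  close (e / 2) (picard Z) (picard Z').
Proof.
move=> fZ fZ' e0 c sigma t.
have /orP[t0|t0] := le_total t 0.
  by rewrite !picard_init// subrr enorm0 mulr_ge0// divr_ge0.
have w0 : 0 <= 1 + `|sigma| by rewrite addr_ge0.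
have h s : 0 <= s -> enorm (field Z s (Z sigma s) - field Z' s (Z' sigma s)) <=
    (e / 2 * (1 + `|sigma|)) * (rate * expR (rate * s)).
  move=> s0; apply: le_trans (flow_field_dist L0 lipK mu01 _ _ _ _ fZ fZ') _.
  have h1 := c sigma s; rewrite /weight (max_l s0) in h1.
  have h2 := gap_close fZ fZ' e0 c s0.
  apply: (@le_trans _ _ (L * (e * ((1 + `|sigma|) * expR (rate * s)) +
      e * expR (rate * s) * mass))).
    by rewrite ler_pM2l// lerD.
  rewrite (_ : _ * (_ + _) =
    e * expR (rate * s) * (L * ((1 + `|sigma|) + mass))); last by ring.
  rewrite (_ : _ / 2 * _ * _ =
    e * expR (rate * s) * ((1 + `|sigma|) * (rate / 2))); last by ring.
  rewrite ler_wpM2l ?mulr_ge0 ?expR_ge0//.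
  apply: (@le_trans _ _ ((1 + `|sigma|) * (L * (1 + mass)))).
    rewrite mulrCA ler_pM2l// mulrDr mulr1 lerD2l -[leLHS]mul1r ler_wpM2r//.
      exact: le_trans mass_ge1.
    by rewrite lerDl.
  by rewrite ler_wpM2l// ler_pdivlMr// /rate [leLHS]mulrC lerDr.
apply: le_trans (picard_dist fZ fZ' t0 h) _.
rewrite subrr enorm0 add0r /weight (max_l t0) mulrA ler_wpM2l ?gerBl//.
by rewrite mulr_ge0// divr_ge0.
Qed.

Let iterate n := iter n picard (frozen tau0).

Let flow_iterate n : flow (iterate n).
Proof. by elim: n => [|n IH]; [exact: flow_frozen|exact: flow_picard]. Qed.

Let base : R := enorm (K 0 0) + L * mass.

Let base_ge0 : 0 <= base.
Proof.
by rewrite addr_ge0 ?enorm_ge0// mulr_ge0 ?(ltW L0)// (le_trans _ mass_ge1).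
Qed.

(** The field at a frozen path grows at most linearly in the history, and t <=
    exp(rate * t) because the rate is at least 1. *)
Let iterate_base : close base (iterate 1) (iterate 0).
Proof.
move=> sigma t; rewrite /iterate/=.
have /orP[t0|t0] := le_total t 0.
  by rewrite !picard_init// subrr enorm0 mulr_ge0.
have w0 : 0 <= 1 + `|sigma| by rewrite addr_ge0.
rewrite /picard addrC addKr.
apply: (@le_trans _ _ (\int[leb]_(s in `[0, t]) (base * (1 + `|sigma|)))).
  apply: enorm_vec_integral => //.
  - exact: (flow_field_integrable _ _ flow_frozen).
  - by apply/within_continuous_integrable/continuous_subspaceT => s; exact: cvg_cst.
  move=> s /=; rewrite in_itv/= => /andP[s0 _].
  rewrite (frozen_ge0 _ s0).
  have Kb x sigma' : enorm (K x sigma') <= enorm (K 0 0) + L * (enorm x + `|sigma'|).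
    apply: le_trans (enorm_le_distD _ (K 0 0)) _; rewrite lerD2l.
    by have := lipK x 0 sigma' 0; rewrite !subr0.
  have x0 : enorm (history_at sigma 0) <= `|sigma|.
    have h0 : - tau <= 0 <= (0 : R) by rewrite lexx oppr_le0 ltW.
    by rewrite (history_at_in _ h0); exact: le_history_norm.
  set x := history_at sigma 0 in x0 *.
  have ic c := finite_measure_integrable_cst mu0 (c : R) measurableT.
  have im := integrable_history_norm mu01.
  have i1 : mu0.-integrable setT (EFin \o (fun sigma' : E => enorm x + `|sigma'|)).
    by apply: integrableD_EFin => //; exact: ic.
  apply: (@le_trans _ _ (\int[mu0]_sigma'
    (enorm (K 0 0) + L * (enorm x + `|sigma'|)))).
    apply: enorm_vec_integral => //.
    - exact: (kernel_segment_integrable L0 lipK mu01 flow_frozen).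
    - by apply: integrableD_EFin => //; [exact: ic|exact: integrableZ_EFin].
    move=> sigma' _; apply: le_trans (Kb _ _) _.
    rewrite lerD2l ler_pM2l// lerD2l.
    apply: history_norm_le => // u.
    rewrite /flow_segment segmentE; last exact: max0_ge0.
      exact: (le_history_norm sigma').
    exact: (flow_within flow_frozen).
  rewrite RintegralD//; [|exact: ic|exact: integrableZ_EFin].
  rewrite RintegralZl// RintegralD//; last exact: ic.
  rewrite !Rintegral_probability_cst.
  have i0 : 0 <= \int[mu0]_sigma' `|sigma'| by exact: Rintegral_ge0.
  have arith (k l a b I : R) : 0 <= k -> 0 <= l -> a <= b -> 0 <= a -> 0 <= I ->
      k + l * (a + I) <= (k + l * (1 + I)) * (1 + b).
    move=> k0 l0 ab a0 I0; rewrite -subr_ge0.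
    rewrite (_ : _ - _ = l + k * b + l * (b - a) + l * I * b); last by ring.
    by rewrite !addr_ge0 ?mulr_ge0 ?subr_ge0// (le_trans a0).
  exact: (arith _ _ _ _ _ (enorm_ge0 _) (ltW L0) x0 (enorm_ge0 _) i0).
rewrite Rintegral_cst//= lebesgue_measure_itv/= lte_fin.
rewrite /weight (max_l t0) mulrA ler_wpM2l ?mulr_ge0//.
have te : t <= expR (rate * t).
  apply: (@le_trans _ _ (1 + rate * t)); last exact: expR_ge1Dx.
  by rewrite ler_wpDl// -[leLHS]mul1r ler_wpM2r.
case: ifPn => [_|_] /=; first by rewrite subr0.
exact: expR_ge0.
Qed.

Let iterateS n : iterate n.+1 = picard (iterate n).
Proof. by []. Qed.

Let iterate_close n : close (base * 2^-1 ^+ n) (iterate n.+1) (iterate n).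
Proof.
elim: n => [|n IH]; first by rewrite expr0 mulr1; exact: iterate_base.
have e0 : 0 <= base * 2^-1 ^+ n by rewrite mulr_ge0// exprn_ge0// invr_ge0.
rewrite exprSr mulrA (iterateS n.+1) {2}(iterateS n).
exact: (picard_contraction (flow_iterate n.+1) (flow_iterate n) e0 IH).
Qed.

Let radius : R := d%:R * (2 * base).

Let radius_ge0 : 0 <= radius.
Proof. by rewrite !mulr_ge0. Qed.

(** The iterates converge geometrically in the weighted distance; being a flow
    and being fixed both pass to the limit. *)
Lemma picard_fixpoint : exists2 Z, flow Z & picard Z = Z.
Proof.
have /choice[Z ZE] sigma : exists z : R -> 'rV[R]_d, forall t n,
    enorm (z t - iterate n sigma t) <= radius * weight sigma t * 2^-1 ^+ n.
  suff /choice[z zE] t : exists z, forall n,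
      enorm (z - iterate n sigma t) <= radius * weight sigma t * 2^-1 ^+ n.
    by exists z.
  have h n : enorm (iterate n.+1 sigma t - iterate n sigma t) <=
      base * weight sigma t * 2^-1 ^+ n.
    by rewrite mulrAC; exact: iterate_close.
  have [l lE] := geometric_cauchy_vector (u := fun n => iterate n sigma t) h.
  by exists l => n; have := lE n; rewrite /radius !mulrA.
have Zclose n : close (radius * 2^-1 ^+ n) Z (iterate n).
  by move=> sigma t; rewrite mulrAC; exact: ZE.
have half0 n : 0 <= 2^-1 ^+ n :> R by rewrite exprn_ge0// invr_ge0.
have fZ : flow Z.
  split=> [sigma t|sigma sigma' t|sigma t t0].
  - apply/cvg_enormP => e e0.
    have e3 : 0 < e / 3 by rewrite divr_gt0.
    (* W bounds the weight for times s < t + 1, so the convergence is uniform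
       near t *)
    pose W := (1 + `|sigma|) * expR (rate * (Num.max t 0 + 1)).
    have [n hn] := geometric_lt (radius * W) e3.
    have ct : continuous (iterate n sigma) by exact: (flow_continuous (flow_iterate n)).
    have /cvg_enormP/(_ _ e3) h := ct t.
    have wW s : s < t + 1 -> weight sigma s <= W.
      move=> st; rewrite /weight /W ler_wpM2l ?addr_ge0// ler_expR ler_pM2l//.
      rewrite ge_max addr_ge0 ?max0_ge0// andbT (le_trans (ltW st))// lerD2r.
      by rewrite le_max lexx.
    have near_e s : s < t + 1 -> enorm (Z sigma s - iterate n sigma s) < e / 3.
      move=> st; apply: le_lt_trans (ZE _ _ _) _; apply: le_lt_trans hn.
      by rewrite ler_wpM2r// ler_wpM2l// wW.
    have : t < t + 1 by rewrite ltrDl.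
    move=> /lt_nbhsl; apply: filterS2 h => s hs st.
    have h1 := near_e _ st.
    have h2 : enorm (Z sigma t - iterate n sigma t) < e / 3.
      by apply: near_e; rewrite ltrDl.
    have h3 := ler_enorm_distD (iterate n sigma s) (Z sigma s) (Z sigma t).
    have h4 := ler_enorm_distD (iterate n sigma t) (iterate n sigma s) (Z sigma t).
    rewrite [X in _ <= _ + X]enormBC in h4; lra.
  - apply: (@ler_geometric _ _ _
      (radius * weight sigma t + radius * weight sigma' t)) => n.
    have h1 := ZE sigma t n; have h2 := ZE sigma' t n.
    have h3 := flow_lipschitz (flow_iterate n) sigma sigma' t.
    have h4 := ler_enorm_distD (iterate n sigma t) (Z sigma t) (Z sigma' t).
    have h5 := ler_enorm_distD (iterate n sigma' t) (iterate n sigma t) (Z sigma' t).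
    rewrite [X in _ <= _ + X]enormBC in h5; rewrite mulrDl.
    rewrite addrCA (le_trans h4)// lerD// (le_trans h5)// lerD//.
  - apply/eqP; rewrite -subr_eq0; apply/eqP/enorm0_eq0/eqP.
    rewrite eq_le enorm_ge0 andbT.
    apply: (@ler_geometric _ _ _ (radius * weight sigma t)) => n.
    by rewrite add0r -(flow_init (flow_iterate n))//; exact: ZE.
exists Z => //; apply/funext => sigma; apply/funext => t.
apply/eqP; rewrite -subr_eq0; apply/eqP/enorm0_eq0/eqP.
rewrite eq_le enorm_ge0 andbT.
apply: (@ler_geometric _ _ _ (radius * weight sigma t)) => n.
rewrite add0r; apply: le_trans (ler_enorm_distD (iterate n.+1 sigma t) _ _) _.
have e0 : 0 <= radius * 2^-1 ^+ n by rewrite mulr_ge0.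
have h1 := picard_contraction fZ (flow_iterate n) e0 (Zclose n) sigma t.
have h2 := Zclose n.+1 sigma t; rewrite enormBC in h2.
apply: le_trans (lerD h1 h2) _.
rewrite exprSr le_eqVlt; apply/orP; left; apply/eqP; by field.
Qed.

End picard.

(** * Existence and the theorem *)

Section existence.
Context {R : realType} {d : nat} {tau : R}.
Local Notation E := (history d tau).
Variables (K : 'rV[R]_d -> E -> 'rV[R]_d) (L : R).
Hypothesis tau0 : 0 < tau.
Hypothesis L0 : 0 < L.
Hypothesis lipK : forall (x x' : 'rV[R]_d) (sigma sigma' : E),
  enorm (K x sigma - K x' sigma') <= L * (enorm (x - x') + `|sigma - sigma'|).
Variable mu0 : probability E R.
Hypothesis mu01 : finite_first_moment mu0.
Variable Z : E -> R -> 'rV[R]_d.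
Hypothesis flowZ : flow L tau0 Z.

Definition flow_law (t : R) : probability E R :=
  image_law mu0 (flow_segment_measurable L0 flowZ t).

Let flow_lawP t : has_law mu0 (flow_segment Z t) (flow_law t).
Proof. exact: has_law_image. Qed.

Lemma flow_law_first_moment t : finite_first_moment (flow_law t).
Proof.
rewrite /finite_first_moment (has_law_ge0_integral (flow_lawP t))//.
  have := history_lipschitz_segment L0 flowZ t ler01 history_norm_lipschitz.
  move=> /(history_lipschitz_integrable mu01)/integrableP[_].
  by under eq_integral do rewrite /= normr_id.
by apply/measurable_EFinP; exact: history_lipschitz_measurable history_norm_lipschitz.
Qed.

(** Both laws are images of the same initial law, so the same initial history
    couples them. *)
Lemma w1_flow_law s t :
  w1 (flow_law s) (flow_law t) <= \int[mu0]_sigma segment_gap Z s Z t sigma.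
Proof.
apply: w1_le; [exact: flow_law_first_moment..|] => phi lp.
have mphi := history_lipschitz_measurable lp.
have i u : mu0.-integrable setT (EFin \o (phi \o flow_segment Z u)).
  exact: (history_lipschitz_integrable mu01
    (history_lipschitz_segment L0 flowZ u ler01 lp)).
have il u : (flow_law u).-integrable setT (EFin \o phi).
  exact: history_lipschitz_integrable (flow_law_first_moment u) lp.
rewrite (has_law_Rintegral (flow_lawP s) mphi (il s)).
rewrite (has_law_Rintegral (flow_lawP t) mphi (il t)).
rewrite -(RintegralB measurableT (i s) (i t)).
apply: le_Rintegral => //.
- exact: (integrableB_EFin measurableT (i s) (i t)).
- exact: (segment_gap_integrable L0 mu01 _ _ flowZ flowZ).
- move=> sigma _; apply: le_trans (ler_norm _) _.
  by apply: le_trans (lp _ _) _; rewrite mul1r.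
Qed.

Lemma flow_law_continuous : P1_continuous_curve flow_law.
Proof.
split=> [t _|t t0]; first exact: flow_law_first_moment.
rewrite (_ : (fun s => _) = fun s => (w1 (flow_law s) (flow_law t))%:E); last first.
  by apply/funext => s; rewrite w1E//; exact: flow_law_first_moment.
apply: cvg_EFin; first exact: nearW.
apply: (@cvg_within_filter R R (fun s => w1 (flow_law s) (flow_law t)) (nbhs t)).
apply/cvgrPdist_lt => e e0.
apply: filterS (segment_gap_continuous L0 mu01 t flowZ e0) => s.
rewrite sub0r normrN ger0_norm; last by apply: w1_ge0; exact: flow_law_first_moment.
exact/le_lt_trans/w1_flow_law.
Qed.

(** Change of variables: the field of the flow is the mean field of its law,
    so that fixed points solve the equation. *)
Lemma mean_field_flow_law s x : mean_field K flow_law s x = flow_field K mu0 Z s x.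
Proof.
apply/rowP => i; rewrite !mxE.
have lK := kernel_coord_lipschitz lipK x i.
rewrite (has_law_Rintegral (flow_lawP s))//.
  exact: history_lipschitz_measurable lK.
exact: (history_lipschitz_integrable (flow_law_first_moment s) lK).
Qed.

(** Composing the fixed flow with the initial variable gives the process; its
    law is the image of the initial law under the flow. *)
Lemma pathwise_solution_flow dO (Omega : measurableType dO)
    (P : probability Omega R) (X0 : Omega -> E) :
  has_law P X0 mu0 -> picard K tau0 mu0 Z = Z ->
  pathwise_solution K P X0 (fun w => Z (X0 w)) flow_law.
Proof.
move=> [mX0 X0l] ZE; split.
- by move=> w; exact: (flow_within flowZ).
- move=> t t0; have mS := flow_segment_measurable L0 flowZ t.
  rewrite (_ : (fun w => _) = flow_segment Z t \o X0); last first.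
    by apply/funext => w; rewrite /flow_segment /= max_l.
  split; first exact: measurableT_comp.
  move=> A mA; rewrite [LHS](X0l (flow_segment Z t @^-1` A))//.
  by rewrite -[X in measurable X]setTI; exact: mS.
- exact: flow_law_continuous.
- apply: aeW => w; split=> t ht.
    rewrite -[in LHS]ZE /picard (frozen_ge0 _ _ ht); congr (_ + _).
    apply/rowP => i; rewrite !mxE; apply: eq_Rintegral => s _.
    by rewrite mean_field_flow_law.
  have /andP[_ t0] := ht.
  by rewrite (flow_init flowZ)// frozenE.
Qed.

End existence.

Unset Implicit Arguments.
Set Strict Implicit.

Theorem theorem3p2 (R : realType) (d : nat) (tau : R)
    (K : 'rV[R]_d -> history d tau -> 'rV[R]_d)
    (d_gt0 : (0 < d)%N) (tau_gt0 : 0 < tau)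
    (K_lipschitz : exists2 L : R, 0 < L &
      forall (x x' : 'rV[R]_d) (sigma sigma' : history d tau),
        enorm (K x sigma - K x' sigma') <=
          L * (enorm (x - x') + `|sigma - sigma'|)) :
  (forall R0 : R, 0 < R0 ->
   forall mu0 : probability (history d tau) R, supported_in_ball mu0 R0 ->
   forall (dO : measure_display) (Omega : measurableType dO)
     (P : probability Omega R) (X0 : Omega -> history d tau),
   has_law P X0 mu0 ->
   (exists (X : Omega -> R -> 'rV[R]_d)
      (mu : R -> probability (history d tau) R),
      pathwise_solution K P X0 X mu) /\
   (forall (X Y : Omega -> R -> 'rV[R]_d)
      (mu nu : R -> probability (history d tau) R),
      pathwise_solution K P X0 X mu -> pathwise_solution K P X0 Y nu ->
      {ae P, forall w, forall t, - tau <= t -> X w t = Y w t}))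
  /\
  (exists r : R -> R,
   [/\ {within `[0, +oo[, continuous r},
       forall t, 0 <= t -> 0 <= r t,
       r 0 = 1 &
       forall R0 : R, 0 < R0 ->
       forall mu_in nu_in : probability (history d tau) R,
       supported_in_ball mu_in R0 -> supported_in_ball nu_in R0 ->
       forall (d1 : measure_display) (Omega1 : measurableType d1)
         (P1 : probability Omega1 R) (X0 : Omega1 -> history d tau)
         (X : Omega1 -> R -> 'rV[R]_d)
         (mu : R -> probability (history d tau) R),
       has_law P1 X0 mu_in -> pathwise_solution K P1 X0 X mu ->
       forall (d2 : measure_display) (Omega2 : measurableType d2)
         (P2 : probability Omega2 R) (Y0 : Omega2 -> history d tau)
         (Y : Omega2 -> R -> 'rV[R]_d)
         (nu : R -> probability (history d tau) R),
       has_law P2 Y0 nu_in -> pathwise_solution K P2 Y0 Y nu ->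
       forall t, 0 <= t ->
         (W1 (mu t) (nu t) <= (r t)%:E * W1 mu_in nu_in)%E]).
Proof.
have [L L0 lipK] := K_lipschitz; split.
  move=> R0 R00 mu0 mu0R0 dO Omega P X0 X0l.
  have mu01 := supported_in_ball_first_moment (ltW R00) mu0R0.
  split.
    have [Z flowZ ZE] := picard_fixpoint tau_gt0 L0 lipK mu01.
    exists (fun w => Z (X0 w)), (flow_law L0 mu0 flowZ).
    exact: pathwise_solution_flow.
  move=> X Y mu nu; exact: (pathwise_uniqueness tau_gt0 L0 lipK mu01 X0l).
exists (fun t => expR (L * t) * expR (expR (L * t) * L * t)); split.
- have cE : continuous (fun t => expR (L * t)).
    move=> t; apply: (@continuous_comp _ _ _ (fun t => L * t) expR).
      by apply: cvgMr => //; exact: cvg_id.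
    exact: continuous_expR.
  apply: continuous_subspaceT => t; apply: cvgM; first exact: cE.
  apply: (@continuous_comp _ _ _ (fun t => expR (L * t) * L * t) expR).
    apply: cvgM; last exact: cvg_id.
    by apply: cvgMl => //; exact: cE.
  exact: continuous_expR.
- by move=> t _; rewrite mulr_ge0 ?expR_ge0.
- by rewrite !mulr0 expR0 mulr1.
- move=> R0 R00 mu_in nu_in mu_inR nu_inR d1 Omega1 P1 X0 X mu X0l Xsol.
  move=> d2 Omega2 P2 Y0 Y nu Y0l Ysol t t0.
  have mu_in1 := supported_in_ball_first_moment (ltW R00) mu_inR.
  have nu_in1 := supported_in_ball_first_moment (ltW R00) nu_inR.
  have [mu1 _] := sol_curve Xsol; have [nu1 _] := sol_curve Ysol.
  rewrite -(w1E (mu1 _ t0) (nu1 _ t0)) -(w1E mu_in1 nu_in1) -EFinM lee_fin.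
  exact: (w1_stability tau_gt0 L0 lipK mu_in1 nu_in1 X0l Y0l Xsol Ysol t0).
Qed.
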